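(* Let $\Lambda$ be a row-finite $k$-graph without sources and let $R$ be a commutative ring with identity $1\neq 0$. The following statements are equivalent: (i) $\Lambda$ is cofinal; (ii) $T_\Lambda$ is a simple $\mathbb{Z}^k$-monoid; (iii) $\emptyset$ and $\Lambda^0$ are the only hereditary and saturated subsets of $\Lambda^0$; (iv) $\mathrm{KP}_R(\Lambda)$ is graded basic ideal simple; (v) the only basic ideal of $\mathrm{KP}_R(\Lambda)$ containing $p_v$ for some $v\in\Lambda^0$ is $\mathrm{KP}_R(\Lambda)$ itself.
   Context: **$k$-graphs.** $\mathbb{N}=\{0,1,2,\dots\}$, $k\ge 1$, $e_i$ is the $i$-th standard generator of $\mathbb{N}^k$; $\mathbb{N}^k$ is ordered coordinatewise. A $k$-graph is a countable small category $\Lambda$ with nonempty object set $\Lambda^0$ (identified with the identity morphisms), range and source maps $r,s:\Lambda\to\Lambda^0$, and a functor $d:\Lambda\to\mathbb{N}^k$ with the unique factorization property: if $d(\lambda)=m+n$ there are unique $\mu_1,\mu_2\in\Lambda$ with $\lambda=\mu_1\mu_2$, $d(\mu_1)=m$, $d(\mu_2)=n$ (the product $\mu_1\mu_2$ is defined iff $s(\mu_1)=r(\mu_2)$). For $v,w\in\Lambda^0$, $n\in\mathbb{N}^k$: $v\Lambda^n=\{\lambda: r(\lambda)=v, d(\lambda)=n\}$ and $v\Lambda w=\{\lambda: r(\lambda)=v, s(\lambda)=w\}$. $\Lambda$ is row-finite if every $v\Lambda^n$ is finite, and has no sources if every $v\Lambda^n$ is nonempty. A subset $H\subseteq\Lambda^0$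 is hereditary if $r(\lambda)\in H$ implies $s(\lambda)\in H$ for $\lambda\in\Lambda$; it is saturated if for $v\in\Lambda^0$, $n\in\mathbb{N}^k$, $s(v\Lambda^n)\subseteq H$ implies $v\in H$. **Cofinality.** Let $\Omega_k=\{(m,n)\in\mathbb{N}^k\times\mathbb{N}^k: m\le n\}$ be the $k$-graph with $r(m,n)=m$, $s(m,n)=n$, $(m,n)(n,p)=(m,p)$, $d(m,n)=n-m$. $\Lambda^\infty$ is the set of degree-preserving functors $x:\Omega_k\to\Lambda$; $x(m):=x(m,m)\in\Lambda^0$. $\Lambda$ is cofinal if for every $x\in\Lambda^\infty$ and $v\in\Lambda^0$ there is $n\in\mathbb{N}^k$ with $v\Lambda x(n)\ne\emptyset$. **Talented monoid.** $T_\Lambda$ is the commutative monoid generated by symbols $v(n)$ ($v\in\Lambda^0$, $n\in\mathbb{Z}^k$) subject to $v(n)=\sum_{\alpha\in v\Lambda^{e_i}}s(\alpha)(n+e_i)$ for all $v$, $n$ and $i\in\{1,\dots,k\}$ with $v\Lambda^{e_i}\neq\emptyset$. $\mathbb{Z}^k$ acts on it by monoid automorphisms determined by ${}^{n}v(m)=v(m+n)$. With $x\le y$ iff $y=x+z$ for some $z$, a $\mathbb{Z}^k$-order ideal is a submonoid $J$ closed under the action such that $x\le y\in J$ implies $x\in J$. A nonzero conical $\mathbb{Z}^k$-monoid $M$ is simple if $\{0\}$ and $M$ are its only $\mathbb{Z}^k$-order ideals. **Kumjian–Pask algebra.** Let $\Lambda^{\neq0}=\{\lambda: d(\lambda)\ne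 0\}$. $\mathrm{KP}_R(\Lambda)$ is the universal $R$-algebra generated by elements $p_v$ ($v\in\Lambda^0$), $s_\lambda,s_{\lambda^*}$ ($\lambda\in\Lambda^{\neq 0}$) subject to: (KP1) $p_up_v=\delta_{u,v}p_u$; (KP2) $s_\lambda s_\mu=s_{\lambda\mu}$, $s_{\mu^*}s_{\lambda^*}=s_{(\lambda\mu)^*}$ when $s(\lambda)=r(\mu)$, and $p_{r(\lambda)}s_\lambda=s_\lambda=s_\lambda p_{s(\lambda)}$, $p_{s(\lambda)}s_{\lambda^*}=s_{\lambda^*}=s_{\lambda^*}p_{r(\lambda)}$; (KP3) $s_{\lambda^*}s_\mu=\delta_{\lambda,\mu}p_{s(\lambda)}$ when $d(\lambda)=d(\mu)$; (KP4) $p_v=\sum_{\lambda\in v\Lambda^n}s_\lambda s_{\lambda^*}$ for all $v\in\Lambda^0$, $n\in\mathbb{N}^k$ (with $s_v=s_{v^*}=p_v$ for $v\in\Lambda^0$). It is $\mathbb{Z}^k$-graded with degree-$n$ component $\mathrm{span}_R\{s_\lambda s_{\mu^*}: s(\lambda)=s(\mu),\ d(\lambda)-d(\mu)=n\}$. A (two-sided) ideal $I$ is basic if $rp_v\in I$ with $v\in\Lambda^0$, $r\in R\setminus\{0\}$ implies $p_v\in I$. $\mathrm{KP}_R(\Lambda)$ is graded basic ideal simple if its only graded basic ideals are $\{0\}$ and itself. *)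

(* Defs.v *)
From HB Require Import structures.
From mathcomp Require Import all_boot all_order all_algebra generic_quotient.
From mathcomp Require Import boolp classical_sets functions cardinality.

Set Implicit Arguments.
Unset Strict Implicit.
Unset Printing Implicit Defensive.

Import GRing.Theory.

Local Open Scope quotient_scope.
Local Open Scope classical_set_scope.
Local Open Scope ring_scope.

Notation Nk k := {ffun 'I_k -> nat}.
Notation Zk k := {ffun 'I_k -> int}.

Definition Nk_le (k : nat) (m n : Nk k) : bool := [forall i, (m i <= n i)%N].

Definition Nk_sub (k : nat) (m n : Nk k) : Nk k := [ffun i => (m i - n i)%N].

Definition Nk_gen (k : nat) (i : 'I_k) : Nk k := [ffun j => nat_of_bool (i == j)].

Definition Nk_int (k : nat) (n : Nk k) : Zk k := [ffun i => (n i)%:Z].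

(* [comp] is total, but it is constrained (and used) only on the pairs
   [(a, b)] with [src a = rng b]; its other values are irrelevant. *)
Record kgraph (k : nat) := KGraph {
  obj : countType;
  mor : countType;
  rng : mor -> obj;
  src : mor -> obj;
  idm : obj -> mor;
  comp : mor -> mor -> mor;
  deg : mor -> Nk k;
  obj_inhabited : inhabited obj;
  rng_id : forall v, rng (idm v) = v;
  src_id : forall v, src (idm v) = v;
  rng_comp : forall a b, src a = rng b -> rng (comp a b) = rng a;
  src_comp : forall a b, src a = rng b -> src (comp a b) = src b;
  comp_idl : forall a, comp (idm (rng a)) a = a;
  comp_idr : forall a, comp a (idm (src a)) = a;
  compA : forall a b c, src a = rng b -> src b = rng c ->
    comp a (comp b c) = comp (comp a b) c;
  deg_id : forall v, deg (idm v) = 0;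
  deg_comp : forall a b, src a = rng b -> deg (comp a b) = deg a + deg b;
  factorization : forall (a : mor) (m n : Nk k), deg a = m + n ->
    exists! bc : mor * mor, [/\ src bc.1 = rng bc.2, a = comp bc.1 bc.2,
                                deg bc.1 = m & deg bc.2 = n]
}.

Arguments idm {k} _ _.

Section KGraphDefs.
Variables (k : nat) (L : kgraph k).

Definition paths_from (v : obj L) (n : Nk k) : set (mor L) :=
  [set a | rng a = v /\ deg a = n].

Definition paths_between (v w : obj L) : set (mor L) :=
  [set a | rng a = v /\ src a = w].

Definition row_finite := forall v n, finite_set (paths_from v n).

Definition no_sources := forall v n, paths_from v n !=set0.

Definition hereditary (H : set (obj L)) :=
  forall a : mor L, H (rng a) -> H (src a).

Definition saturated (H : set (obj L)) :=
  forall v n, @src k L @` paths_from v n `<=` H -> H v.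

End KGraphDefs.

(* Finite sums over a set [A] are indexed by a duplicate-free enumeration. *)
Definition enumerates (T : eqType) (A : set T) (l : seq T) : Prop :=
  uniq l /\ [set` l] = A.

Section Omega.
Variable k : nat.

Definition omega_mor := {p : Nk k * Nk k | Nk_le p.1 p.2}.

Lemma Nk_le_refl (m : Nk k) : Nk_le m m.
Proof. by apply/forallP. Qed.

Lemma Nk_le_trans (n m p : Nk k) : Nk_le m n -> Nk_le n p -> Nk_le m p.
Proof.
move=> /forallP mn /forallP np; apply/forallP => i; exact: leq_trans (np i).
Qed.

Definition omega_pair (m n : Nk k) (mn : Nk_le m n) : omega_mor :=
  exist (fun p : Nk k * Nk k => Nk_le p.1 p.2) (m, n) mn.

Definition omega_rng (a : omega_mor) : Nk k := (val a).1.
Definition omega_src (a : omega_mor) : Nk k := (val a).2.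
Definition omega_id (m : Nk k) : omega_mor := omega_pair (Nk_le_refl m).

(* [insubd] returns the default value [a] when the pair is not increasing,
   which never happens when [omega_src a = omega_rng b]. *)
Definition omega_comp (a b : omega_mor) : omega_mor :=
  insubd a ((val a).1, (val b).2).
Definition omega_deg (a : omega_mor) : Nk k := Nk_sub (val a).2 (val a).1.

Lemma val_omega_comp a b : omega_src a = omega_rng b ->
  val (omega_comp a b) = ((val a).1, (val b).2).
Proof.
case: a b => [[m n] /= mn] [[n' p] /= np]; rewrite /omega_src /omega_rng /=.
by move=> nn'; rewrite val_insubd /= (Nk_le_trans mn) // nn'.
Qed.

Lemma omega_inhabited : inhabited (Nk k).
Proof. exact: (inhabits 0). Qed.

Lemma omega_rng_comp a b : omega_src a = omega_rng b ->
  omega_rng (omega_comp a b) = omega_rng a.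
Proof. by move=> ab; rewrite /omega_rng val_omega_comp. Qed.

Lemma omega_src_comp a b : omega_src a = omega_rng b ->
  omega_src (omega_comp a b) = omega_src b.
Proof. by move=> ab; rewrite /omega_src val_omega_comp. Qed.

Lemma omega_comp_idl a : omega_comp (omega_id (omega_rng a)) a = a.
Proof. by apply: val_inj; rewrite val_omega_comp // [RHS]surjective_pairing. Qed.

Lemma omega_comp_idr a : omega_comp a (omega_id (omega_src a)) = a.
Proof. by apply: val_inj; rewrite val_omega_comp // [RHS]surjective_pairing. Qed.

Lemma omega_compA a b c : omega_src a = omega_rng b ->
  omega_src b = omega_rng c ->
  omega_comp a (omega_comp b c) = omega_comp (omega_comp a b) c.
Proof.
move=> ab bc; apply: val_inj; rewrite !val_omega_comp ?omega_src_comp //.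
by rewrite omega_rng_comp.
Qed.

Lemma omega_deg_id m : omega_deg (omega_id m) = 0.
Proof. by apply/ffunP => i; rewrite !ffunE subnn. Qed.

Lemma omega_deg_comp a b : omega_src a = omega_rng b ->
  omega_deg (omega_comp a b) = omega_deg a + omega_deg b.
Proof.
move=> ab; rewrite /omega_deg val_omega_comp //=.
case: a b ab => [[m n] /= mn] [[n' p] /= np]; rewrite /omega_src /omega_rng /=.
move=> nn'; subst n'; apply/ffunP => i; rewrite !ffunE.
move/forallP: mn => /(_ i) mn; move/forallP: np => /(_ i) np.
by rewrite [RHS]addnC addnBA // subnK.
Qed.

Lemma omega_factorization (a : omega_mor) (m n : Nk k) :
  omega_deg a = m + n ->
  exists! bc : omega_mor * omega_mor,
    [/\ omega_src bc.1 = omega_rng bc.2, a = omega_comp bc.1 bc.2,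
        omega_deg bc.1 = m & omega_deg bc.2 = n].
Proof.
case: a => [[p q] /= pq] /ffunP dmn.
have {}dmn i : q i = (p i + m i + n i)%N.
  move: (dmn i) (forallP pq i); rewrite !ffunE /= => e pqi.
  by rewrite -addnA -[(m i + n i)%N]e subnKC.
have ppm : Nk_le p (p + m).
  by apply/forallP => i; rewrite ffunE; exact: leq_addr.
have pmq : Nk_le (p + m) q.
  by apply/forallP => i; rewrite ffunE dmn; exact: leq_addr.
exists (omega_pair ppm, omega_pair pmq); split.
  split=> //=.
  - by apply: val_inj; rewrite val_omega_comp.
  - by apply/ffunP => i; rewrite !ffunE addKn.
  - by apply/ffunP => i; rewrite !ffunE dmn addKn.
case=> [[[p1 q1] /= pq1] [[p2 q2] /= pq2]] [].
rewrite /omega_src /omega_rng /= => q1p2; subst p2.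
move=> /(congr1 val); rewrite val_omega_comp //= => -[pp1 qq2] d1 d2.
subst p1 q2.
have q1E : q1 = p + m.
  apply/ffunP => i; move/ffunP: d1 => /(_ i); rewrite !ffunE => <-.
  by rewrite [RHS]subnKC //; exact: (forallP pq1 i).
by subst q1; congr pair; apply: val_inj.
Qed.

Definition Omega : kgraph k :=
  @KGraph k (Nk k) omega_mor omega_rng omega_src omega_id omega_comp omega_deg
    omega_inhabited (fun=> erefl) (fun=> erefl)
    omega_rng_comp omega_src_comp omega_comp_idl omega_comp_idr omega_compA
    omega_deg_id omega_deg_comp omega_factorization.

End Omega.

Record kgraph_functor (k : nat) (A B : kgraph k) := KGraphFunctor {
  fobj : obj A -> obj B;
  fmor : mor A -> mor B;
  fmor_rng : forall a, rng (fmor a) = fobj (rng a);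
  fmor_src : forall a, src (fmor a) = fobj (src a);
  fmor_id : forall v, fmor (idm A v) = idm B (fobj v);
  fmor_comp : forall a b, src a = rng b -> fmor (comp a b) = comp (fmor a) (fmor b);
  fmor_deg : forall a, deg (fmor a) = deg a
}.

Definition infinite_path (k : nat) (L : kgraph k) := kgraph_functor (Omega k) L.

Definition cofinal (k : nat) (L : kgraph k) : Prop :=
  forall (x : infinite_path L) (v : obj L),
    exists n : Nk k, paths_between v (fobj x n) !=set0.

Section OrderIdeals.
Variables (G : zmodType) (M : nmodType) (act : G -> M -> M).

Definition mon_le (x y : M) : Prop := exists z, y = x + z.

Record order_ideal (J : set M) : Prop := OrderIdeal {
  oi_zero : J 0;
  oi_add : forall x y, J x -> J y -> J (x + y);
  oi_act : forall n x, J x -> J (act n x);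
  oi_le : forall x y, mon_le x y -> J y -> J x
}.

Definition conical : Prop := forall x y : M, x + y = 0 -> x = 0 /\ y = 0.

Definition simple_monoid : Prop :=
  [/\ exists x : M, x <> 0,
      conical &
      forall J, order_ideal J -> J = [set 0] \/ J = [set: M]].

End OrderIdeals.

Section Talented.
Variables (k : nat) (L : kgraph k).

(* Words in the generators [v(n)], and the least congruence on them that makes
   concatenation commutative and contains the defining relations. *)
Definition tal_word := seq (obj L * Zk k).

Inductive tal_cong : tal_word -> tal_word -> Prop :=
| TalRefl a : tal_cong a a
| TalSym a b : tal_cong a b -> tal_cong b a
| TalTrans a b c : tal_cong a b -> tal_cong b c -> tal_cong a c
| TalCat a b c d : tal_cong a b -> tal_cong c d -> tal_cong (a ++ c) (b ++ d)
| TalComm a b : tal_cong (a ++ b) (b ++ a)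
| TalRel (v : obj L) (n : Zk k) (i : 'I_k) (l : seq (mor L)) :
    paths_from v (Nk_gen i) !=set0 ->
    enumerates (paths_from v (Nk_gen i)) l ->
    tal_cong [:: (v, n)] [seq (src a, n + Nk_int (Nk_gen i)) | a <- l].

Definition tal_rel : rel tal_word := fun a b => `[< tal_cong a b >].

Lemma tal_rel_refl : reflexive tal_rel.
Proof. by move=> a; apply/asboolP; exact: TalRefl. Qed.

Lemma tal_rel_sym : symmetric tal_rel.
Proof. by move=> a b; apply/asboolP/asboolP; exact: TalSym. Qed.

Lemma tal_rel_trans : transitive tal_rel.
Proof.
by move=> b a c /asboolP ab /asboolP bc; apply/asboolP; exact: TalTrans bc.
Qed.

Canonical tal_equiv := EquivRel tal_rel tal_rel_refl tal_rel_sym tal_rel_trans.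

Definition talented := {eq_quot tal_equiv}.

HB.instance Definition _ := Choice.on talented.
HB.instance Definition _ := Quotient.on talented.
HB.instance Definition _ := EqQuotient.on talented.

Lemma tal_piP (a b : tal_word) :
  \pi_talented a = \pi_talented b <-> tal_cong a b.
Proof. by split=> [/eqquotP/asboolP|ab] //; apply/eqquotP/asboolP. Qed.

Lemma tal_repr (a : tal_word) : tal_cong (repr (\pi_talented a)) a.
Proof. by apply/tal_piP; rewrite reprK. Qed.

Definition tal_zero : talented := \pi_talented [::].
Definition tal_add (x y : talented) : talented := \pi_talented (repr x ++ repr y).

Lemma tal_add_pi a b :
  tal_add (\pi_talented a) (\pi_talented b) = \pi_talented (a ++ b).
Proof. by apply/tal_piP; apply: TalCat; exact: tal_repr. Qed.

Lemma tal_addA : associative tal_add.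
Proof.
elim/quotW=> x; elim/quotW=> y; elim/quotW=> z.
by rewrite (tal_add_pi y z) (tal_add_pi x y) !tal_add_pi catA.
Qed.

Lemma tal_addC : commutative tal_add.
Proof.
elim/quotW=> x; elim/quotW=> y; rewrite !tal_add_pi.
by apply/tal_piP; exact: TalComm.
Qed.

Lemma tal_add0 : left_id tal_zero tal_add.
Proof. by elim/quotW=> x; rewrite tal_add_pi. Qed.

HB.instance Definition _ :=
  GRing.isNmodule.Build talented tal_addA tal_addC tal_add0.

Definition tal_gen (v : obj L) (n : Zk k) : talented := \pi_talented [:: (v, n)].

Definition tal_shift (n : Zk k) (a : tal_word) : tal_word :=
  [seq (p.1, p.2 + n) | p <- a].

Definition tal_act (n : Zk k) (x : talented) : talented :=
  \pi_talented (tal_shift n (repr x)).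

Lemma tal_shift_cong n a b :
  tal_cong a b -> tal_cong (tal_shift n a) (tal_shift n b).
Proof.
elim=> {a b}.
- by move=> a; exact: TalRefl.
- by move=> a b _; exact: TalSym.
- by move=> a b c _ ab _ bc; exact: TalTrans ab bc.
- by move=> a b c d _ ab _ cd; rewrite /tal_shift !map_cat; exact: TalCat.
- by move=> a b; rewrite /tal_shift !map_cat; exact: TalComm.
- move=> v m i l ne le; rewrite /tal_shift -map_comp /=.
  have -> : [seq (src a, m + Nk_int (Nk_gen i) + n) | a <- l] =
            [seq (src a, (m + n) + Nk_int (Nk_gen i)) | a <- l].
    by apply: eq_map => a; rewrite addrAC.
  exact: TalRel.
Qed.

Lemma tal_act_pi n a : tal_act n (\pi_talented a) = \pi_talented (tal_shift n a).
Proof. by apply/tal_piP; apply: tal_shift_cong; exact: tal_repr. Qed.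

Lemma tal_act_gen n v m : tal_act n (tal_gen v m) = tal_gen v (m + n).
Proof. exact: (tal_act_pi n [:: (v, m)]). Qed.

Lemma tal_act_zero n : tal_act n 0 = 0.
Proof. exact: (tal_act_pi n [::]). Qed.

Lemma tal_act_add n x y : tal_act n (x + y) = tal_act n x + tal_act n y.
Proof.
elim/quotW: x => x; elim/quotW: y => y.
rewrite [_ + _ in LHS]tal_add_pi !tal_act_pi [RHS]tal_add_pi.
by rewrite /tal_shift map_cat.
Qed.

Lemma tal_act0 x : tal_act 0 x = x.
Proof.
elim/quotW: x => x; rewrite tal_act_pi /tal_shift; congr \pi.
by rewrite -[RHS]map_id; apply: eq_map => -[v m] /=; rewrite addr0.
Qed.

Lemma tal_actD m n x : tal_act (m + n) x = tal_act m (tal_act n x).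
Proof.
elim/quotW: x => x.
rewrite (tal_act_pi n) !tal_act_pi /tal_shift -map_comp; congr \pi.
by apply: eq_map => -[v p] /=; rewrite -addrA (addrC m).
Qed.

End Talented.

Section KumjianPask.
Variables (k : nat) (L : kgraph k) (R : comNzRingType).

Definition nzpath := {a : mor L | deg a != 0}.

Inductive kp_gen :=
| GenP of obj L
| GenS of nzpath
| GenG of nzpath.

(* The algebra is in general not unital, so that it is presented by non-unital
   terms: formal expressions in the generators, modulo the least congruence
   that contains the axioms of (non-unital, associative) R-algebras and the
   relations (KP1)-(KP4). *)
Inductive kp_term :=
| TGen of kp_gen
| TZero
| TAdd of kp_term & kp_term
| TOpp of kp_term
| TScale of R & kp_term
| TMul of kp_term & kp_term.

Definition tP (v : obj L) : kp_term := TGen (GenP v).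

(* A path of degree 0 is the identity of its range. *)
Definition tS (a : mor L) : kp_term :=
  if insub a is Some u then TGen (GenS u) else tP (rng a).
Definition tG (a : mor L) : kp_term :=
  if insub a is Some u then TGen (GenG u) else tP (rng a).

Definition tsum (s : seq kp_term) : kp_term := foldr TAdd TZero s.

Inductive kp_cong : kp_term -> kp_term -> Prop :=
| KPRefl x : kp_cong x x
| KPSym x y : kp_cong x y -> kp_cong y x
| KPTrans x y z : kp_cong x y -> kp_cong y z -> kp_cong x z
| KPAddCong x x' y y' :
    kp_cong x x' -> kp_cong y y' -> kp_cong (TAdd x y) (TAdd x' y')
| KPOppCong x x' : kp_cong x x' -> kp_cong (TOpp x) (TOpp x')
| KPScaleCong r x x' : kp_cong x x' -> kp_cong (TScale r x) (TScale r x')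
| KPMulCong x x' y y' :
    kp_cong x x' -> kp_cong y y' -> kp_cong (TMul x y) (TMul x' y')
| KPAddA x y z : kp_cong (TAdd x (TAdd y z)) (TAdd (TAdd x y) z)
| KPAddC x y : kp_cong (TAdd x y) (TAdd y x)
| KPAdd0 x : kp_cong (TAdd TZero x) x
| KPAddN x : kp_cong (TAdd (TOpp x) x) TZero
| KPScaleA r s x : kp_cong (TScale r (TScale s x)) (TScale (r * s) x)
| KPScale1 x : kp_cong (TScale 1 x) x
| KPScaleDr r x y :
    kp_cong (TScale r (TAdd x y)) (TAdd (TScale r x) (TScale r y))
| KPScaleDl r s x :
    kp_cong (TScale (r + s) x) (TAdd (TScale r x) (TScale s x))
| KPMulA x y z : kp_cong (TMul x (TMul y z)) (TMul (TMul x y) z)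
| KPMulDl x y z : kp_cong (TMul (TAdd x y) z) (TAdd (TMul x z) (TMul y z))
| KPMulDr x y z : kp_cong (TMul x (TAdd y z)) (TAdd (TMul x y) (TMul x z))
| KPScaleAl r x y : kp_cong (TScale r (TMul x y)) (TMul (TScale r x) y)
| KPScaleAr r x y : kp_cong (TScale r (TMul x y)) (TMul x (TScale r y))
| KP1 (u v : obj L) :
    kp_cong (TMul (tP u) (tP v)) (if u == v then tP u else TZero)
| KP2_mul (a b : nzpath) : src (val a) = rng (val b) ->
    kp_cong (TMul (TGen (GenS a)) (TGen (GenS b))) (tS (comp (val a) (val b)))
| KP2_ghost (a b : nzpath) : src (val a) = rng (val b) ->
    kp_cong (TMul (TGen (GenG b)) (TGen (GenG a))) (tG (comp (val a) (val b)))
| KP2_rng (a : nzpath) :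
    kp_cong (TMul (tP (rng (val a))) (TGen (GenS a))) (TGen (GenS a))
| KP2_src (a : nzpath) :
    kp_cong (TMul (TGen (GenS a)) (tP (src (val a)))) (TGen (GenS a))
| KP2_ghost_src (a : nzpath) :
    kp_cong (TMul (tP (src (val a))) (TGen (GenG a))) (TGen (GenG a))
| KP2_ghost_rng (a : nzpath) :
    kp_cong (TMul (TGen (GenG a)) (tP (rng (val a)))) (TGen (GenG a))
| KP3 (a b : nzpath) : deg (val a) = deg (val b) ->
    kp_cong (TMul (TGen (GenG a)) (TGen (GenS b)))
            (if a == b then tP (src (val a)) else TZero)
| KP4 (v : obj L) (n : Nk k) (l : seq (mor L)) :
    enumerates (paths_from v n) l ->
    kp_cong (tP v) (tsum [seq TMul (tS a) (tG a) | a <- l]).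

HB.instance Definition _ := gen_eqMixin kp_term.
HB.instance Definition _ := gen_choiceMixin kp_term.

Definition kp_rel : rel kp_term := fun x y => `[< kp_cong x y >].

Lemma kp_rel_refl : reflexive kp_rel.
Proof. by move=> x; apply/asboolP; exact: KPRefl. Qed.

Lemma kp_rel_sym : symmetric kp_rel.
Proof. by move=> x y; apply/asboolP/asboolP; exact: KPSym. Qed.

Lemma kp_rel_trans : transitive kp_rel.
Proof.
by move=> y x z /asboolP xy /asboolP yz; apply/asboolP; exact: KPTrans yz.
Qed.

Canonical kp_equiv := EquivRel kp_rel kp_rel_refl kp_rel_sym kp_rel_trans.

Definition KP := {eq_quot kp_equiv}.

HB.instance Definition _ := Choice.on KP.
HB.instance Definition _ := Quotient.on KP.
HB.instance Definition _ := EqQuotient.on KP.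

Lemma kp_piP (x y : kp_term) : \pi_KP x = \pi_KP y <-> kp_cong x y.
Proof. by split=> [/eqquotP/asboolP|xy] //; apply/eqquotP/asboolP. Qed.

Lemma kp_repr (x : kp_term) : kp_cong (repr (\pi_KP x)) x.
Proof. by apply/kp_piP; rewrite reprK. Qed.

Definition kp_zero : KP := \pi_KP TZero.
Definition kp_add (x y : KP) : KP := \pi_KP (TAdd (repr x) (repr y)).
Definition kp_opp (x : KP) : KP := \pi_KP (TOpp (repr x)).
Definition kp_scale (r : R) (x : KP) : KP := \pi_KP (TScale r (repr x)).
Definition kp_mul (x y : KP) : KP := \pi_KP (TMul (repr x) (repr y)).

Lemma kp_add_pi x y : kp_add (\pi_KP x) (\pi_KP y) = \pi_KP (TAdd x y).
Proof. by apply/kp_piP; apply: KPAddCong; exact: kp_repr. Qed.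

Lemma kp_opp_pi x : kp_opp (\pi_KP x) = \pi_KP (TOpp x).
Proof. by apply/kp_piP; apply: KPOppCong; exact: kp_repr. Qed.

Lemma kp_scale_pi r x : kp_scale r (\pi_KP x) = \pi_KP (TScale r x).
Proof. by apply/kp_piP; apply: KPScaleCong; exact: kp_repr. Qed.

Lemma kp_mul_pi x y : kp_mul (\pi_KP x) (\pi_KP y) = \pi_KP (TMul x y).
Proof. by apply/kp_piP; apply: KPMulCong; exact: kp_repr. Qed.

Lemma kp_addA : associative kp_add.
Proof.
elim/quotW=> x; elim/quotW=> y; elim/quotW=> z.
rewrite (kp_add_pi y z) (kp_add_pi x y) !kp_add_pi.
by apply/kp_piP; exact: KPAddA.
Qed.

Lemma kp_addC : commutative kp_add.
Proof.
elim/quotW=> x; elim/quotW=> y; rewrite !kp_add_pi.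
by apply/kp_piP; exact: KPAddC.
Qed.

Lemma kp_add0 : left_id kp_zero kp_add.
Proof.
by elim/quotW=> x; rewrite kp_add_pi; apply/kp_piP; exact: KPAdd0.
Qed.

Lemma kp_addN : left_inverse kp_zero kp_opp kp_add.
Proof.
elim/quotW=> x; rewrite kp_opp_pi kp_add_pi.
by apply/kp_piP; exact: KPAddN.
Qed.

HB.instance Definition _ :=
  GRing.isZmodule.Build KP kp_addA kp_addC kp_add0 kp_addN.

Lemma kp_scaleA r s (x : KP) : kp_scale r (kp_scale s x) = kp_scale (r * s) x.
Proof.
elim/quotW: x => x; rewrite (kp_scale_pi s) !kp_scale_pi.
by apply/kp_piP; exact: KPScaleA.
Qed.

Lemma kp_scale1 : left_id 1 kp_scale.
Proof.
by elim/quotW=> x; rewrite kp_scale_pi; apply/kp_piP; exact: KPScale1.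
Qed.

Lemma kp_scaleDr : right_distributive kp_scale +%R.
Proof.
move=> r; elim/quotW=> x; elim/quotW=> y.
rewrite [_ + _ in LHS]kp_add_pi !kp_scale_pi [RHS]kp_add_pi.
by apply/kp_piP; exact: KPScaleDr.
Qed.

Lemma kp_scaleDl (x : KP) : {morph kp_scale^~ x : r s / r + s}.
Proof.
move=> r s; elim/quotW: x => x; rewrite !kp_scale_pi [RHS]kp_add_pi.
by apply/kp_piP; exact: KPScaleDl.
Qed.

HB.instance Definition _ := GRing.Zmodule_isLmodule.Build R KP
  kp_scaleA kp_scale1 kp_scaleDr kp_scaleDl.

Lemma kp_mulA : associative kp_mul.
Proof.
elim/quotW=> x; elim/quotW=> y; elim/quotW=> z.
rewrite (kp_mul_pi y z) (kp_mul_pi x y) !kp_mul_pi.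
by apply/kp_piP; exact: KPMulA.
Qed.

Lemma kp_mulDl : left_distributive kp_mul +%R.
Proof.
elim/quotW=> x; elim/quotW=> y; elim/quotW=> z.
rewrite [X in kp_mul X _]kp_add_pi !kp_mul_pi [RHS]kp_add_pi.
by apply/kp_piP; exact: KPMulDl.
Qed.

Lemma kp_mulDr : right_distributive kp_mul +%R.
Proof.
elim/quotW=> x; elim/quotW=> y; elim/quotW=> z.
rewrite [X in kp_mul _ X]kp_add_pi !kp_mul_pi [RHS]kp_add_pi.
by apply/kp_piP; exact: KPMulDr.
Qed.

Lemma kp_scaleAl r (x y : KP) : r *: kp_mul x y = kp_mul (r *: x) y.
Proof.
elim/quotW: x => x; elim/quotW: y => y.
rewrite [X in _ = kp_mul X _]kp_scale_pi !kp_mul_pi.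
by rewrite [LHS]kp_scale_pi; apply/kp_piP; exact: KPScaleAl.
Qed.

Lemma kp_scaleAr r (x y : KP) : r *: kp_mul x y = kp_mul x (r *: y).
Proof.
elim/quotW: x => x; elim/quotW: y => y.
rewrite [X in _ = kp_mul _ X]kp_scale_pi !kp_mul_pi.
by rewrite [LHS]kp_scale_pi; apply/kp_piP; exact: KPScaleAr.
Qed.

Definition kp_p (v : obj L) : KP := \pi_KP (tP v).
Definition kp_s (a : mor L) : KP := \pi_KP (tS a).
Definition kp_g (a : mor L) : KP := \pi_KP (tG a).

Definition kp_homog (n : Zk k) : set KP :=
  [set x | exists2 l : seq (R * (mor L * mor L)),
     (forall t, t \in l -> src t.2.1 = src t.2.2 /\
                           Nk_int (deg t.2.1) - Nk_int (deg t.2.2) = n) &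
     x = \sum_(t <- l) t.1 *: kp_mul (kp_s t.2.1) (kp_g t.2.2)].

Record kp_ideal (I : set KP) : Prop := KPIdeal {
  ideal_zero : I 0;
  ideal_add : forall x y, I x -> I y -> I (x + y);
  ideal_scale : forall r x, I x -> I (r *: x);
  ideal_mull : forall x y, I y -> I (kp_mul x y);
  ideal_mulr : forall x y, I x -> I (kp_mul x y)
}.

(* [I] is the sum of its intersections with the homogeneous components. *)
Definition kp_graded (I : set KP) : Prop :=
  forall x, I x -> exists (s : seq (Zk k)) (y : Zk k -> KP),
    [/\ uniq s, forall n, n \in s -> (I `&` kp_homog n) (y n) &
        x = \sum_(n <- s) y n].

Definition kp_basic (I : set KP) : Prop :=
  forall (r : R) (v : obj L), r != 0 -> I (r *: kp_p v) -> I (kp_p v).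

Definition graded_basic_ideal_simple : Prop :=
  forall I, kp_ideal I -> kp_graded I -> kp_basic I ->
    I = [set 0] \/ I = [set: KP].

End KumjianPask.

Arguments kp_p {k L} R v.

(* Main.v *)
Require Import Defs.
From mathcomp Require Import all_boot all_order all_algebra.
From mathcomp Require Import boolp classical_sets functions cardinality.

(** Everything is compared with the absence of nontrivial hereditary saturated
    sets of vertices.

    Cofinality: a vertex outside of a hereditary saturated set [H] starts an
    infinite path that avoids [H] (saturation provides paths of every degree
    from such a vertex that end outside of [H]), and cofinality then forces [H]
    to be empty.
    Conversely, the vertices from which no path leads to a given infinite path
    form a hereditary saturated set.

    Talented monoid: for [H] hereditary and saturated, a vertex is in [H] if and
    only if all sources of [v Lambda^(e_i)] are. Hence the condition that all
    letters of a word are in [H] is invariant under the defining relations, and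
    cuts out an order ideal with vertex set [H]. Conversely, an order ideal is
    determined by its vertices, which form a hereditary saturated set.

    Kumjian-Pask algebra: the vertices of an ideal form a hereditary saturated
    set, and an ideal that contains all vertices is everything. If a basic ideal
    contains no vertex, it contains no nonzero homogeneous element: by (KP4) a
    homogeneous element is a combination of monomials [s a ** g b] with all [a]
    of the same degree and all [b] of the same degree, and by (KP3) each
    coefficient is isolated, times a vertex, by multiplying by a ghost path on
    the left and a path on the right ([homogeneous_zero]).

    For the converse, a hereditary saturated [H] must be realized as the vertex
    set of a graded basic ideal. This ideal is the kernel of a representation on
    the functions from pairs of an infinite path avoiding [H] and an element of
    [Z^k] to [R]: paths act through shifts and concatenations of infinite paths,
    and translate the second component by their degree. The vertices of [H] act
    by zero, whereas a vertex outside of [H] starts an infinite path avoiding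
    [H], so that its nonzero multiples do not vanish ([kernel_scale_p]); the
    second component separates the degrees, which makes the kernel graded
    ([kernel_graded]). *)

Set Implicit Arguments.
Unset Strict Implicit.
Unset Printing Implicit Defensive.

Import GRing.Theory.

(* From here on, [comp] and [compA] concern paths and not functions. *)
Import Defs.

Local Open Scope quotient_scope.
Local Open Scope classical_set_scope.
Local Open Scope ring_scope.

(** * Degrees *)

Section Degrees.
Variable k : nat.
Implicit Types m n p : Nk k.

Lemma Nk_subK m n : Nk_le m n -> m + Nk_sub n m = n.
Proof.
by move=> /forallP mn; apply/ffunP => i; rewrite !ffunE; exact: subnKC.
Qed.

Lemma Nk_le_addr m n : Nk_le m (m + n).
Proof. by apply/forallP => i; rewrite ffunE; exact: leq_addr. Qed.

Lemma Nk_le0 n : Nk_le 0 n.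
Proof. by apply/forallP => i; rewrite ffunE. Qed.

Lemma Nk_addI m n p : m + n = m + p -> n = p.
Proof.
move=> /ffunP e; apply/ffunP => i; move: (e i); rewrite !ffunE.
by move/eqP; rewrite eqn_add2l => /eqP.
Qed.

Lemma Nk_int_add m n : Nk_int (m + n) = Nk_int m + Nk_int n.
Proof. by apply/ffunP => i; rewrite !ffunE -PoszD. Qed.

Lemma Nk_int0 : Nk_int (0 : Nk k) = 0.
Proof. by apply/ffunP => i; rewrite !ffunE. Qed.

Lemma Nk_int_inj m n : Nk_int m = Nk_int n -> m = n.
Proof.
by move=> /ffunP e; apply/ffunP => i; move: (e i); rewrite !ffunE => -[].
Qed.

(** Induction on a degree by removing one generator at a time. *)
Lemma Nk_ind (P : Nk k -> Prop) :
  P 0 -> (forall i n, P n -> P (Nk_gen i + n)) -> forall n, P n.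
Proof.
move=> P0 PS n; have [s le_s] := ubnP (\sum_i n i)%N.
elim: s n le_s => // s IHs n le_s.
case: (pselect (exists i, n i != 0%N)) => [[i ni]|n0]; last first.
  suff -> : n = 0 by [].
  apply/ffunP => i; rewrite ffunE; apply/eqP; apply: contrapT => ni.
  by apply: n0; exists i; apply/negP.
have le_in : Nk_le (Nk_gen i) n.
  by apply/forallP => j; rewrite ffunE; case: eqVneq => // <-; rewrite lt0n.
rewrite -(Nk_subK le_in); apply/PS/IHs; rewrite -ltnS.
apply: leq_trans le_s; rewrite ltnS (bigD1 i) //= [X in (_ < X)%N](bigD1 i) //=.
rewrite -addSn leq_add //; first by rewrite !ffunE eqxx subn1 prednK // lt0n.
by apply: leq_sum => j _; rewrite ffunE leq_subr.
Qed.

End Degrees.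

(** * Factorization of paths *)

Section Factorization.
Variables (k : nat) (L : kgraph k).
Implicit Types (a b c : mor L) (m n : Nk k) (v : obj L).

(** Uniqueness of factorizations, as a cancellation rule. *)
Lemma comp_inj a b a' b' : src a = rng b -> src a' = rng b' ->
  deg a = deg a' -> comp a b = comp a' b' -> a = a' /\ b = b'.
Proof.
move=> ab ab' daa' e.
have dbb' : deg b = deg b'.
  by apply: (@Nk_addI _ (deg a)); rewrite [in RHS]daa' -!deg_comp // e.
have [z [_ uz]] := factorization (deg_comp ab).
have z1 := uz (a, b) (And4 ab erefl erefl erefl).
have z2 := uz (a', b') (And4 ab' e (esym daa') (esym dbb')).
by move: z1; rewrite z2 => -[].
Qed.

Lemma deg0_id a : deg a = 0 -> a = idm L (rng a).
Proof.
move=> da; case: (@comp_inj a (idm L (src a)) (idm L (rng a)) a) => //.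
- by rewrite rng_id.
- by rewrite src_id.
- by rewrite deg_id da.
- by rewrite comp_idl comp_idr.
Qed.

(** The factorization of a path [a] with a first factor of degree [m]; it is
    meaningful when [m <= deg a]. *)
Definition factor a m : mor L * mor L :=
  xget (a, a) [set bc | [/\ src bc.1 = rng bc.2, a = comp bc.1 bc.2
                          & deg bc.1 = m]].
Definition pre a m := (factor a m).1.
Definition suf a m := (factor a m).2.

Lemma factorP a m : Nk_le m (deg a) ->
  [/\ src (pre a m) = rng (suf a m), a = comp (pre a m) (suf a m)
    & deg (pre a m) = m].
Proof.
move=> ma; rewrite /pre /suf /factor.
set A := (X in xget _ X).
have [bc [[h1 h2 h3 _] _]] := factorization (esym (Nk_subK ma)).
have /(xgetPex (a, a)) : exists x, A x by exists bc.
by [].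
Qed.

Lemma src_pre a m : Nk_le m (deg a) -> src (pre a m) = rng (suf a m).
Proof. by case/factorP. Qed.
Lemma factorE a m : Nk_le m (deg a) -> comp (pre a m) (suf a m) = a.
Proof. by case/factorP. Qed.
Lemma deg_pre a m : Nk_le m (deg a) -> deg (pre a m) = m.
Proof. by case/factorP. Qed.
Lemma rng_pre a m : Nk_le m (deg a) -> rng (pre a m) = rng a.
Proof. by case/factorP => s e _; rewrite [in RHS]e rng_comp. Qed.
Lemma src_suf a m : Nk_le m (deg a) -> src (suf a m) = src a.
Proof. by case/factorP => s e _; rewrite [in RHS]e src_comp. Qed.
Lemma deg_suf a m n : deg a = m + n -> deg (suf a m) = n.
Proof.
move=> e; have ma : Nk_le m (deg a) by rewrite e Nk_le_addr.
by apply: (@Nk_addI _ m); rewrite -e -{1}(deg_pre ma) -deg_comp ?src_pre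
  ?factorE.
Qed.

Lemma factor_comp a b m : src a = rng b -> deg a = m ->
  pre (comp a b) m = a /\ suf (comp a b) m = b.
Proof.
move=> ab <-.
have le : Nk_le (deg a) (deg (comp a b)) by rewrite deg_comp ?Nk_le_addr.
by apply: comp_inj; rewrite ?src_pre ?deg_pre ?factorE.
Qed.

Lemma pre_comp a b m : src a = rng b -> Nk_le m (deg a) ->
  pre (comp a b) m = pre a m.
Proof.
move=> ab ma; rewrite -{1}(factorE ma) -compA ?src_pre ?src_suf //.
by case: (@factor_comp (pre a m) (comp (suf a m) b) m);
  rewrite ?rng_comp ?src_suf ?src_pre ?deg_pre.
Qed.

Lemma suf_comp a b m : src a = rng b -> Nk_le m (deg a) ->
  suf (comp a b) m = comp (suf a m) b.
Proof.
move=> ab ma; rewrite -{1}(factorE ma) -compA ?src_pre ?src_suf //.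
by case: (@factor_comp (pre a m) (comp (suf a m) b) m);
  rewrite ?rng_comp ?src_suf ?src_pre ?deg_pre.
Qed.

Lemma pre_deg a : pre a (deg a) = a.
Proof.
by case: (@factor_comp a (idm L (src a)) (deg a)); rewrite ?rng_id ?comp_idr.
Qed.

Lemma pre_pre a m n : Nk_le m n -> Nk_le n (deg a) ->
  pre (pre a n) m = pre a m.
Proof.
move=> mn na; rewrite -[in RHS](factorE na) pre_comp ?src_pre //.
by rewrite deg_pre.
Qed.

Lemma suf0 a : suf a 0 = a.
Proof.
by case: (@factor_comp (idm L (rng a)) a 0); rewrite ?src_id ?deg_id ?comp_idl.
Qed.

Lemma suf_suf a m n : Nk_le (m + n) (deg a) ->
  suf (suf a m) n = suf a (m + n).
Proof.
move=> mna; have ma := Nk_le_trans (Nk_le_addr m n) mna.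
have dp := deg_pre mna.
have mp : Nk_le m (deg (pre a (m + n))) by rewrite dp Nk_le_addr.
have -> : suf a m = comp (suf (pre a (m + n)) m) (suf a (m + n)).
  by rewrite -{1}(factorE mna) suf_comp ?src_pre.
have [] // := @factor_comp (suf (pre a (m + n)) m) (suf a (m + n)) n.
  by rewrite src_suf // src_pre.
by rewrite (deg_suf dp).
Qed.

End Factorization.

(** * Infinite paths *)

Section InfinitePaths.
Variables (k : nat) (L : kgraph k) (H : set (obj L)).
Hypothesis hH : hereditary H.
Implicit Types (a b c : mor L) (m n : Nk k) (y : Nk k -> mor L).

(** An infinite path is encoded by the family of its initial segments: [y n] is
    the one of degree [n]. It avoids [H] when none of its vertices is in [H]. *)
Record avoiding y : Prop := Avoiding {
  deg_seg : forall n, deg (y n) = n;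
  pre_seg : forall m n, Nk_le m n -> pre (y n) m = y m;
  seg_notin : forall n, ~ H (src (y n))
}.

(** Removal of the initial segment of degree [m], and concatenation with a path
    [a]; the latter is meaningful when the source of [a] is the range of [y]. *)
Definition shift m y : Nk k -> mor L := fun n => suf (y (m + n)) m.
Definition cat_path a y : Nk k -> mor L := fun n => pre (comp a (y n)) n.

Section Avoiding.
Variable y : Nk k -> mor L.
Hypothesis ay : avoiding y.

Let dy := deg_seg ay.

Lemma rng_seg n : rng (y n) = rng (y 0).
Proof. by rewrite -(pre_seg ay (Nk_le0 n)) rng_pre // Nk_le0. Qed.

Lemma seg0 : y 0 = idm L (rng (y 0)).
Proof. exact: deg0_id. Qed.

Lemma seg_add m n : src (y m) = rng (shift m y n) /\
  y (m + n) = comp (y m) (shift m y n).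
Proof.
have le : Nk_le m (deg (y (m + n))) by rewrite dy Nk_le_addr.
by rewrite -(pre_seg ay (Nk_le_addr m n)) src_pre // factorE.
Qed.

Lemma shift_avoiding m : avoiding (shift m y).
Proof.
split=> [n|n p np|n].
- exact: deg_suf.
- have [sn en] := seg_add m n; have [sp ep] := seg_add m p.
  have mnp : m + p = (m + n) + Nk_sub p n by rewrite -addrA Nk_subK.
  have [s' e'] := seg_add (m + n) (Nk_sub p n).
  have dn : deg (shift m y n) = n by exact: deg_suf.
  have sc : src (shift m y n) = rng (shift (m + n) y (Nk_sub p n)).
    by rewrite -s' /shift src_suf // dy Nk_le_addr.
  have -> : shift m y p = comp (shift m y n) (shift (m + n) y (Nk_sub p n)).
    move: e'; rewrite -mnp ep en -compA // => e'.
    by have [] := comp_inj sp _ erefl e'; rewrite ?rng_comp.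
  by have [] := @factor_comp _ _ _ _ n sc dn.
- by rewrite src_suf ?dy ?Nk_le_addr //; exact: seg_notin.
Qed.

Lemma rng_shift m n : rng (shift m y n) = src (y m).
Proof. by have [] := seg_add m n. Qed.

Lemma shift0 : shift 0 y = y.
Proof. by apply/funext => n; rewrite /shift suf0 add0r. Qed.

Lemma shift_shift m n : shift n (shift m y) = shift (m + n) y.
Proof.
apply/funext => p; rewrite /shift addrA suf_suf // dy; exact: Nk_le_addr.
Qed.

Section Cat.
Variable a : mor L.
Hypothesis sa : src a = rng (y 0).

Let sa' n : src a = rng (y n). Proof. by rewrite rng_seg. Qed.

Let le_cat n : Nk_le n (deg (comp a (y n))).
Proof. by rewrite deg_comp // dy addrC Nk_le_addr. Qed.

Lemma cat_path_deg n : cat_path a y (deg a + n) = comp a (y n).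
Proof.
have [sn en] := seg_add n (deg a).
rewrite /cat_path addrC en compA // pre_comp ?src_comp //.
  have <- : deg (comp a (y n)) = n + deg a by rewrite deg_comp // dy addrC.
  by rewrite pre_deg.
by rewrite deg_comp // dy addrC Nk_le_refl.
Qed.

Lemma cat_path_seg : cat_path a y (deg a) = a.
Proof.
by rewrite -[X in cat_path _ _ X]addr0 cat_path_deg seg0 -sa comp_idr.
Qed.

Lemma rng_cat_path n : rng (cat_path a y n) = rng a.
Proof. by rewrite /cat_path rng_pre // rng_comp. Qed.

Lemma cat_avoiding : avoiding (cat_path a y).
Proof.
split=> [n|m n mn|n].
- exact: deg_pre.
- rewrite /cat_path pre_pre //.
  have [sm em] := seg_add m (Nk_sub n m); move: em; rewrite Nk_subK // => ->.
  by rewrite compA // pre_comp // src_comp.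
- move=> Hn; apply: (seg_notin ay (n := n)).
  rewrite -(src_comp (sa' n)) -(src_suf (le_cat n)).
  by apply: hH; rewrite -src_pre.
Qed.

Lemma shift_cat : shift (deg a) (cat_path a y) = y.
Proof.
apply/funext => n; rewrite /shift cat_path_deg.
by have [] := @factor_comp _ _ _ _ (deg a) (sa' n) erefl.
Qed.

Lemma cat_cat b : src b = rng a ->
  cat_path b (cat_path a y) = cat_path (comp b a) y.
Proof.
move=> sb; apply/funext => n; rewrite /cat_path.
have dn := deg_pre (le_cat n).
have rn : src b = rng (pre (comp a (y n)) n) by rewrite rng_pre // rng_comp.
rewrite -(compA sb (sa' n)).
rewrite -[in RHS](factorE (le_cat n)) compA ?src_pre //.
rewrite [RHS]pre_comp ?src_comp ?src_pre //.
by rewrite deg_comp // dn addrC Nk_le_addr.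
Qed.

End Cat.

Lemma cat_id : cat_path (idm L (rng (y 0))) y = y.
Proof.
apply/funext => n; rewrite /cat_path -(rng_seg n) comp_idl.
by rewrite -{2}(dy n) pre_deg.
Qed.

Lemma cat_shift m : cat_path (y m) (shift m y) = y.
Proof.
apply/funext => n; rewrite /cat_path; have [_ <-] := seg_add m n.
by rewrite (pre_seg ay) // addrC Nk_le_addr.
Qed.

End Avoiding.

(** Every vertex outside a saturated set is the range of an infinite path that
    avoids this set: saturation yields a path of degree [(1, ..., 1)] ending
    outside of [H], and this can be iterated. *)
Lemma avoiding_exists v : saturated H -> ~ H v ->
  exists2 y, avoiding y & rng (y 0) = v.
Proof.
move=> sH Hv; pose cst j : Nk k := [ffun => j].
have step w : exists a, ~ H w -> [/\ rng a = w, deg a = cst 1%N & ~ H (src a)].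
  have [Hw|Hw] := pselect (H w); first by exists (idm L w) => /(_ Hw).
  apply: contrapT => no; apply/Hw/(sH w (cst 1%N)) => u [a [ra da] <-].
  by apply: contrapT => Hu; apply: no; exists a.
have [f fP] := choice step.
pose P := fix P j := if j is j'.+1 then comp (P j') (f (src (P j')))
                     else idm L v.
have PP j : [/\ rng (P j) = v, deg (P j) = cst j & ~ H (src (P j))].
  elim: j => [|j [IHr IHd IHH]] /=.
    by rewrite rng_id src_id deg_id.
  have [fr fd fH] := fP _ IHH.
  rewrite rng_comp ?src_comp ?deg_comp //; split=> //.
  by rewrite IHd fd; apply/ffunP => i; rewrite !ffunE addrC.
have preP i j n : (i <= j)%N -> Nk_le n (cst i) -> pre (P j) n = pre (P i) n.
  move=> ij ni; elim: j ij => [|j IHj]; first by rewrite leqn0 => /eqP ->.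
  rewrite leq_eqVlt => /orP[/eqP-> //|]; rewrite ltnS => ij.
  have [_ dj Hj] := PP j; have [fr _ _] := fP _ Hj.
  rewrite /= pre_comp ?IHj // dj; apply: Nk_le_trans ni _.
  by apply/forallP => l; rewrite !ffunE.
(* [N n] copies of the degree [(1, ..., 1)] dominate [n]. *)
pose N (n : Nk k) : nat := (\sum_i n i)%N.
have leN (n : Nk k) : Nk_le n (cst (N n)).
  by apply/forallP => i; rewrite ffunE /N (bigD1 i) //= leq_addr.
have leP n : Nk_le n (deg (P (N n))) by have [_ -> _] := PP (N n).
exists (fun n => pre (P (N n)) n); last first.
  by rewrite rng_pre //; have [] := PP (N 0).
split=> [n|m n mn|n]; first exact: deg_pre.
  rewrite pre_pre //; apply: preP => //.
  by apply: leq_sum => i _; exact: (forallP mn).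
move=> Hn; have [_ _] := PP (N n); apply.
by rewrite -(src_suf (leP n)); apply: hH; rewrite -src_pre.
Qed.

(** The functor on [Omega k] with given initial segments. *)
Lemma avoiding_functor y : avoiding y ->
  exists x : infinite_path L, forall n, fobj x n = src (y n).
Proof.
move=> ay; pose F (a : mor (Omega k)) := suf (y (omega_src a)) (omega_rng a).
have segP (a : mor (Omega k)) : src (y (omega_rng a)) = rng (F a) /\
    y (omega_src a) = comp (y (omega_rng a)) (F a).
  case: a => -[m n] /= mn; rewrite /F /omega_src /omega_rng /=.
  have le : Nk_le m (deg (y n)) by rewrite (deg_seg ay).
  by rewrite -(pre_seg ay mn) src_pre // factorE.
have srcF (a : mor (Omega k)) : src (F a) = src (y (src a)).
  by have [s e] := segP a; rewrite -(src_comp s) -e.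
unshelve eexists.
- unshelve refine
    (@KGraphFunctor k (Omega k) L (fun n => src (y n)) F _ _ _ _ _).
  + by move=> a; have [-> _] := segP a.
  + exact: srcF.
  + move=> n; apply: etrans (deg0_id _) _.
      apply: deg_suf; rewrite (deg_seg ay) addr0 //.
    by have [<- _] := segP (omega_id n).
  + move=> a b; rewrite -[src a]/(omega_src a) -[rng b]/(omega_rng b) => ab.
    have [sa ea] := segP a; have [sb eb] := segP b.
    have [sc ec] := segP (omega_comp a b).
    move: sc ec; rewrite omega_rng_comp // omega_src_comp // => sc ec.
    have ab' : src (F a) = rng (F b) by rewrite srcF -sb -ab.
    apply: (proj2 (comp_inj sc _ erefl _)); first by rewrite rng_comp.
    by rewrite compA // -ec -ea ab eb.
  + case=> -[m n] /= mn; rewrite /F /omega_src /omega_rng /=.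
    by apply: deg_suf; rewrite (deg_seg ay) Nk_subK.
- by [].
Qed.

End InfinitePaths.

(** * Cofinality and hereditary saturated sets *)

(** There are no hereditary saturated sets of vertices besides the empty one and
    the full one. *)
Definition trivial_hersat (k : nat) (L : kgraph k) : Prop :=
  forall H : set (obj L), hereditary H -> saturated H ->
    H = set0 \/ H = [set: obj L].

Section Cofinal.
Variables (k : nat) (L : kgraph k).

(** A vertex outside of [H] starts an infinite path [x] that avoids [H]. If some
    [u] is in [H], cofinality yields a path from [u] to a vertex of [x], which
    is in [H] because [H] is hereditary: a contradiction. *)
Lemma cofinal_trivial_hersat : cofinal L -> trivial_hersat L.
Proof.
move=> cof H hH sH; have [->|/set0P[u Hu]] := eqVneq H set0; [by left|right].
apply/seteqP; split=> // v _; apply: contrapT => Hv.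
have [y ay _] := avoiding_exists hH sH Hv.
have [x xE] := avoiding_functor ay.
have [n [a [ra sa]]] := cof x u.
by apply: (seg_notin ay (n := n)); rewrite -xE -sa; apply: hH; rewrite ra.
Qed.

(** The vertices that are not connected to a given infinite path form a
    hereditary saturated set, which misses the range of this path. *)
Lemma trivial_hersat_cofinal : trivial_hersat L -> cofinal L.
Proof.
move=> triv x v.
pose H := [set w | forall n : Nk k, ~ (paths_between w (fobj x n) !=set0)].
suff H0 : H = set0.
  apply: contrapT => nv; have : H v by move=> n vn; apply: nv; exists n.
  by rewrite H0.
case: (triv H) => // [a Ha n [b [rb sb]]|w n Hn m [a [ra sa]]|HT]; last first.
- have : H (fobj x 0) by rewrite HT.
  move/(_ 0); case; exists (idm L (fobj x 0)).
  by split; rewrite ?rng_id ?src_id.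
- pose c := fmor x (omega_pair (Nk_le_addr m n) : mor (Omega k)).
  have rc : src a = rng c by rewrite sa fmor_rng.
  have dc : deg c = n.
    by rewrite fmor_deg; apply/ffunP => i; rewrite !ffunE addKn.
  have le : Nk_le n (deg (comp a c)) by rewrite deg_comp // dc addrC Nk_le_addr.
  apply: (Hn (src (pre (comp a c) n)) _ (m + n)).
    exists (pre (comp a c) n) => //.
    by split; rewrite ?deg_pre ?rng_pre ?rng_comp.
  exists (suf (comp a c) n); split; first by rewrite src_pre.
  by rewrite src_suf // src_comp // fmor_src.
- apply: (Ha n); exists (comp a b); split; first by rewrite rng_comp.
  by rewrite src_comp.
Qed.

End Cofinal.

(** * The talented monoid *)

Section Enumeration.
Variable T : eqType.
Implicit Types (A : set T) (l : seq T).

Lemma enumeratesP A l : enumerates A l -> forall a, a \in l <-> A a.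
Proof. by case=> _ <-. Qed.

End Enumeration.

Lemma finite_enumerates (T : choiceType) (A : set T) : finite_set A ->
  exists l, enumerates A l.
Proof.
case/finite_seqP => l ->; exists (undup l); split; first exact: undup_uniq.
by apply/seteqP; split=> a /=; rewrite mem_undup.
Qed.

Section Talented.
Variables (k : nat) (L : kgraph k).
Hypotheses (Lrf : row_finite L) (Lns : no_sources L).
Implicit Types (w : tal_word L) (x y : talented L) (v : obj L).

Lemma tal_catE (w w' : tal_word L) :
  \pi_(talented L) w + \pi_(talented L) w' = \pi_(talented L) (w ++ w').
Proof. exact: tal_add_pi. Qed.

Lemma tal_cong_nil w w' : tal_cong w w' -> w = [::] <-> w' = [::].
Proof.
have cat0 (a b : tal_word L) : a ++ b = [::] <-> a = [::] /\ b = [::].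
  by case: a b => [|? ?] [|? ?]; split=> // -[].
elim=> {w w'} //.
- by move=> a b _ ->.
- by move=> a b c _ -> _ ->.
- by move=> a b c d _ e _ e'; rewrite !cat0 e e'.
- by move=> a b; rewrite !cat0 and_comm.
- move=> v n i l [a aP] lE; split=> // l0.
  by have := (enumeratesP lE a).2 aP; case: l l0 {lE}.
Qed.

Lemma tal_gen_neq0 v n : tal_gen v n <> 0.
Proof. by case/tal_piP/tal_cong_nil => _ /(_ erefl). Qed.

(** The vertices of all letters of a word are in [H]. For a hereditary saturated
    set [H] this depends on the class of the word only. *)
Definition letters_in (H : set (obj L)) w := forall p, p \in w -> H p.1.

Lemma letters_in_cat H w w' :
  letters_in H (w ++ w') <-> letters_in H w /\ letters_in H w'.
Proof.
split=> [h|[h h'] p]; last by rewrite mem_cat => /orP[/h|/h'].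
by split=> p pw; apply: h; rewrite mem_cat pw ?orbT.
Qed.

Lemma tal_cong_letters_in H : hereditary H -> saturated H ->
  forall w w', tal_cong w w' -> letters_in H w <-> letters_in H w'.
Proof.
move=> hH sH w w'; elim=> {w w'} //.
- by move=> a b _ ->.
- by move=> a b c _ -> _ ->.
- by move=> a b c d _ e _ e'; rewrite !letters_in_cat e e'.
- by move=> a b; rewrite !letters_in_cat and_comm.
- move=> v n i l _ lE; have lP := enumeratesP lE.
  split=> [Hv p /mapP[a la ->]|Hl p].
    apply: hH; have [-> _] := (lP a).1 la.
    by apply: (Hv (v, n)); rewrite mem_seq1.
  rewrite mem_seq1 => /eqP -> /=; apply: (sH _ (Nk_gen i)) => _ [a /lP la <-].
  by apply: (Hl (src a, n + Nk_int (Nk_gen i))); exact: map_f.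
Qed.

(** The words with all letters in [H] form an order ideal. *)
Lemma simple_trivial_hersat : simple_monoid (@tal_act k L) -> trivial_hersat L.
Proof.
case=> _ _ simp H hH sH; pose J := [set x : talented L | letters_in H (repr x)].
have JE w : J (\pi_(talented L) w) <-> letters_in H w.
  exact/(tal_cong_letters_in hH sH)/tal_repr.
have JD x y : J (x + y) <-> J x /\ J y.
  elim/quotW: x => x; elim/quotW: y => y.
  by rewrite tal_catE !JE letters_in_cat.
have JP v : J (tal_gen v 0) <-> H v.
  rewrite JE; split=> [|Hv p]; last by rewrite mem_seq1 => /eqP ->.
  by move=> h; apply: (h (v, 0)); rewrite mem_seq1.
case: (simp J).
- split=> [|x y Jx Jy|n x|x y [z ->] /JD[]//]; first exact/JE.
    exact/JD.
  elim/quotW: x => w; rewrite tal_act_pi !JE => Hw p /mapP[q qw ->] /=.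
  exact: Hw.
- move=> J0; left; apply/seteqP; split=> // v /JP.
  by rewrite J0 => /tal_gen_neq0.
- by move=> JT; right; apply/seteqP; split=> // v _; apply/JP; rewrite JT.
Qed.

Lemma tal_conical : conical (talented L).
Proof.
elim/quotW=> x; elim/quotW=> y; rewrite tal_catE => /tal_piP/tal_cong_nil[_].
by move=> /(_ erefl); case: x y => [|? ?] [|? ?].
Qed.

(** The vertices of an order ideal form a hereditary saturated set: by induction
    on the degree [n], a vertex belongs to it if and only if the sources of all
    its paths of degree [n] do. *)
Lemma trivial_hersat_simple : trivial_hersat L -> simple_monoid (@tal_act k L).
Proof.
move=> triv; split; [|exact: tal_conical|].
  by case: (obj_inhabited L) => v; exists (tal_gen v 0); exact: tal_gen_neq0.
move=> J iJ; pose H := [set v | J (tal_gen v 0)].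
have JH v n : J (tal_gen v n) <-> H v.
  split=> [/(oi_act iJ (- n))|/(oi_act iJ n)]; rewrite tal_act_gen ?subrr //.
  by rewrite add0r.
have J_addl (x y : talented L) : J (x + y) -> J x.
  by apply: (oi_le iJ); exists y.
have J_cat w w' : J (\pi_(talented L) (w ++ w')) <->
    J (\pi_(talented L) w) /\ J (\pi_(talented L) w').
  rewrite -tal_catE; split=> [h|[]]; last exact: (oi_add iJ).
  by split; [exact: J_addl h|apply: J_addl; rewrite addrC; exact: h].
have J_letters w : J (\pi_(talented L) w) <-> letters_in H w.
  elim: w => [|[v n] w IHw]; first by split=> // _; exact: (oi_zero iJ).
  rewrite -cat1s J_cat IHw letters_in_cat; split=> -[h1 h2]; split=> //.
    by move=> p; rewrite mem_seq1 => /eqP -> /=; apply/(JH _ n).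
  by apply/(JH v n)/(h1 (v, n)); rewrite mem_seq1.
have H_gen v i : H v <-> forall a, paths_from v (Nk_gen i) a -> H (src a).
  have [l lP] := finite_enumerates (Lrf v (Nk_gen i)).
  have e := (tal_piP _ _).2 (TalRel 0 (Lns v (Nk_gen i)) lP).
  rewrite /H /= [tal_gen v 0]e J_letters.
  split=> [h a /(enumeratesP lP a).2 la|h p].
    by apply: (h (src a, 0 + Nk_int (Nk_gen i))); exact: map_f.
  by case/mapP => a /(enumeratesP lP a)/h Ha ->.
have H_deg n v : H v <-> forall a, paths_from v n a -> H (src a).
  elim/Nk_ind: n v => [|i n IHn] v.
    split=> [Hv a [ra /deg0_id da]|]; first by rewrite da src_id ra.
    move=> /(_ (idm L v)); rewrite src_id; apply.
    by split; rewrite ?rng_id ?deg_id.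
  rewrite (H_gen v i); split=> [h a [ra da]|h a [ra da]].
    have le : Nk_le (Nk_gen i) (deg a) by rewrite da Nk_le_addr.
    rewrite -(src_suf le); apply: (IHn (src (pre a (Nk_gen i)))).1.
      by apply: h; split; rewrite ?rng_pre ?deg_pre.
    by split; [rewrite src_pre|rewrite (deg_suf da)].
  apply/IHn => b [rb db]; rewrite -(src_comp (esym rb)); apply: h.
  by split; rewrite ?rng_comp ?deg_comp ?da ?db.
have [||H0|HT] := triv H.
- by move=> a Ha; apply: (H_deg (deg a) (rng a)).1.
- by move=> v n Hn; apply/(H_deg n) => a av; apply: Hn; exists a.
- left; apply/seteqP; split=> [|_ ->]; last exact: (oi_zero iJ).
  elim/quotW=> [[|p w]] //= /J_letters/(_ p); rewrite mem_head H0.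
  by move/(_ erefl).
- right; apply/seteqP; split=> //; elim/quotW=> w _.
  by apply/J_letters; rewrite HT.
Qed.

End Talented.

(** * The Kumjian-Pask algebra *)

Lemma sum_delta (T : eqType) (V : nmodType) (l : seq T) j (F : T -> V) :
  uniq l ->
  \sum_(i <- l) (if j == i then F i else 0) = if j \in l then F j else 0.
Proof.
move=> ul; case: ifPn => jl.
  rewrite (bigD1_seq j) //= eqxx big1 ?addr0 // => i.
  by rewrite eq_sym => /negPf ->.
by rewrite big1_seq // => i /andP[_ il]; case: eqP jl => // ->; rewrite il.
Qed.

Lemma sum_fibers (T T' : eqType) (V : nmodType) (l : seq T) (h : T -> T')
    (F : T -> V) :
  \sum_(t <- l) F t = \sum_(i <- undup (map h l)) \sum_(t <- l | h t == i) F t.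
Proof.
under [RHS]eq_bigr => i _ do rewrite big_mkcond.
rewrite exchange_big /= [LHS]big_seq [RHS]big_seq; apply: eq_bigr => t tl.
by rewrite sum_delta ?undup_uniq // mem_undup map_f.
Qed.

Lemma sum_group (R : pzRingType) (T : eqType) (V : lmodType R) (l : seq (R * T))
    (F : T -> V) :
  \sum_(t <- l) t.1 *: F t.2 =
  \sum_(i <- undup (map snd l)) (\sum_(t <- l | t.2 == i) t.1) *: F i.
Proof.
rewrite (sum_fibers _ snd); apply: eq_bigr => i _; rewrite scaler_suml.
by apply: eq_bigr => t /eqP ->.
Qed.

Local Notation "x ** y" := (kp_mul x y) (at level 40, left associativity).

Section KumjianPask.
Variables (k : nat) (L : kgraph k) (R : comNzRingType).
Implicit Types (a b c : mor L) (u v : obj L) (n m : Nk k) (x y z : KP L R).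
Local Notation p := (kp_p R).
Local Notation s := (kp_s R).
Local Notation g := (kp_g R).

Lemma kp_mul0l x : 0 ** x = 0.
Proof. by apply: (addrI (0 ** x)); rewrite -kp_mulDl !addr0. Qed.

Lemma kp_mul0r x : x ** 0 = 0.
Proof. by apply: (addrI (x ** 0)); rewrite -kp_mulDr !addr0. Qed.

Lemma kp_mul_suml (T : Type) (l : seq T) (F : T -> KP L R) x :
  (\sum_(i <- l) F i) ** x = \sum_(i <- l) F i ** x.
Proof.
by apply: (big_morph (fun y => y ** x)) => [y z|]; rewrite ?kp_mulDl ?kp_mul0l.
Qed.

Lemma kp_mul_sumr (T : Type) (l : seq T) (F : T -> KP L R) x :
  x ** (\sum_(i <- l) F i) = \sum_(i <- l) x ** F i.
Proof.
by apply: (big_morph (fun y => x ** y)) => [y z|]; rewrite ?kp_mulDr ?kp_mul0r.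
Qed.

Lemma tS_id v : tS R (idm L v) = tP R v.
Proof. by rewrite /tS insubF ?deg_id ?eqxx // rng_id. Qed.
Lemma tG_id v : tG R (idm L v) = tP R v.
Proof. by rewrite /tG insubF ?deg_id ?eqxx // rng_id. Qed.
Lemma tS_nz (a : nzpath L) : tS R (val a) = TGen R (GenS a).
Proof. by rewrite /tS valK. Qed.
Lemma tG_nz (a : nzpath L) : tG R (val a) = TGen R (GenG a).
Proof. by rewrite /tG valK. Qed.

Lemma kp_s_id v : s (idm L v) = p v. Proof. by rewrite /kp_s tS_id. Qed.
Lemma kp_g_id v : g (idm L v) = p v. Proof. by rewrite /kp_g tG_id. Qed.

Lemma id_or_nzpath a :
  (exists v, a = idm L v) \/ exists u : nzpath L, a = val u.
Proof.
have [/deg0_id ->|da] := eqVneq (deg a) 0; first by left; exists (rng a).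
by right; exists (Sub a da : nzpath L).
Qed.

(** The relations (KP1)-(KP4) for paths of arbitrary degree. *)

Lemma kp_pp u v : p u ** p v = if u == v then p u else 0.
Proof.
rewrite [LHS]kp_mul_pi; apply: etrans ((kp_piP _ _).2 (KP1 R u v)) _.
by case: ifP.
Qed.

Lemma kp_ps a : p (rng a) ** s a = s a.
Proof.
have [[v ->]|[u ->]] := id_or_nzpath a.
  by rewrite rng_id kp_s_id kp_pp eqxx.
by rewrite [LHS]kp_mul_pi; apply/kp_piP; rewrite tS_nz; exact: KP2_rng.
Qed.

Lemma kp_sp a : s a ** p (src a) = s a.
Proof.
have [[v ->]|[u ->]] := id_or_nzpath a.
  by rewrite src_id kp_s_id kp_pp eqxx.
by rewrite [LHS]kp_mul_pi; apply/kp_piP; rewrite tS_nz; exact: KP2_src.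
Qed.

Lemma kp_pg a : p (src a) ** g a = g a.
Proof.
have [[v ->]|[u ->]] := id_or_nzpath a.
  by rewrite src_id kp_g_id kp_pp eqxx.
by rewrite [LHS]kp_mul_pi; apply/kp_piP; rewrite tG_nz; exact: KP2_ghost_src.
Qed.

Lemma kp_gp a : g a ** p (rng a) = g a.
Proof.
have [[v ->]|[u ->]] := id_or_nzpath a.
  by rewrite rng_id kp_g_id kp_pp eqxx.
by rewrite [LHS]kp_mul_pi; apply/kp_piP; rewrite tG_nz; exact: KP2_ghost_rng.
Qed.

Lemma kp_ss a b : src a = rng b -> s a ** s b = s (comp a b).
Proof.
have [[v ->]|[a' ->]] := id_or_nzpath a.
  by rewrite src_id => ->; rewrite kp_s_id kp_ps comp_idl.
have [[w ->]|[b' ->]] := id_or_nzpath b.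
  by rewrite rng_id => <-; rewrite kp_s_id kp_sp comp_idr.
move=> ab; rewrite [LHS]kp_mul_pi; apply/kp_piP; rewrite !tS_nz; exact: KP2_mul.
Qed.

Lemma kp_gg a b : src a = rng b -> g b ** g a = g (comp a b).
Proof.
have [[v ->]|[a' ->]] := id_or_nzpath a.
  by rewrite src_id => ->; rewrite kp_g_id kp_gp comp_idl.
have [[w ->]|[b' ->]] := id_or_nzpath b.
  by rewrite rng_id => <-; rewrite kp_g_id kp_pg comp_idr.
move=> ab; rewrite [LHS]kp_mul_pi; apply/kp_piP; rewrite !tG_nz.
exact: KP2_ghost.
Qed.

Lemma kp_ss0 a b : src a != rng b -> s a ** s b = 0.
Proof.
move=> /negPf ab; rewrite -(kp_sp a) -(kp_ps b) kp_mulA -(kp_mulA (s a)).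
by rewrite kp_pp ab kp_mul0r kp_mul0l.
Qed.

Lemma kp_gs a b : deg a = deg b -> g a ** s b = if a == b then p (src a) else 0.
Proof.
have [[v ->]|[a' ->]] := id_or_nzpath a.
  rewrite deg_id => /esym/deg0_id ->; rewrite kp_g_id kp_s_id kp_pp src_id.
  by rewrite (can_eq (@rng_id _ L)).
have [[w ->]|[b' ->]] := id_or_nzpath b.
  by rewrite deg_id => da; have := valP a'; rewrite /= da eqxx.
move=> ab; rewrite [LHS]kp_mul_pi !tS_nz !tG_nz (inj_eq val_inj).
by apply: etrans ((kp_piP _ _).2 (KP3 R ab)) _; case: ifP.
Qed.

Lemma kp_tsum (l : seq (kp_term L R)) :
  \pi_(KP L R) (tsum l) = \sum_(t <- l) \pi_(KP L R) t.
Proof.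
elim: l => [|t l IHl]; first by rewrite big_nil.
by rewrite big_cons -IHl; exact: esym (kp_add_pi _ _).
Qed.

Lemma kp_p_sum v n l : enumerates (paths_from v n) l ->
  p v = \sum_(a <- l) s a ** g a.
Proof.
move=> lE; apply: etrans ((kp_piP _ _).2 (KP4 R lE)) _.
by rewrite kp_tsum big_map; apply: eq_bigr => a _; rewrite -kp_mul_pi.
Qed.

Lemma kp_sg_expand a b n l : src a = src b ->
  enumerates (paths_from (src a) n) l ->
  s a ** g b = \sum_(c <- l) s (comp a c) ** g (comp b c).
Proof.
move=> ab lE; rewrite -(kp_sp a) (kp_p_sum lE) kp_mul_sumr kp_mul_suml.
rewrite !big_seq; apply: eq_bigr => c /(enumeratesP lE c).1[rc _].
by rewrite kp_mulA kp_ss // -kp_mulA kp_gg // -ab.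
Qed.

Lemma kp_ind (P : KP L R -> Prop) :
    (forall v, P (p v)) -> (forall a, P (s a)) -> (forall a, P (g a)) ->
    P 0 -> (forall x y, P x -> P y -> P (x + y)) ->
    (forall r x, P x -> P (r *: x)) ->
    (forall x y, P x -> P y -> P (x ** y)) ->
  forall x, P x.
Proof.
move=> Pp Ps Pg P0 PD PZ PM; elim/quotW; elim=> //.
- by case=> [v|a|a]; [exact: Pp|rewrite -tS_nz; exact: Ps
    |rewrite -tG_nz; exact: Pg].
- by move=> x Px y Py; rewrite -[X in P X]kp_add_pi; exact: PD.
- move=> x Px; rewrite -[X in P X]kp_opp_pi.
  by have := PZ (-1) _ Px; rewrite scaleN1r.
- by move=> r x Px; rewrite -[X in P X]kp_scale_pi; exact: PZ.
- by move=> x Px y Py; rewrite -[X in P X]kp_mul_pi; exact: PM.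
Qed.

(** * The vertices of an ideal *)

Section Ideal.
Variable I : set (KP L R).
Hypothesis iI : kp_ideal I.
Hypothesis Lrf : row_finite L.

Lemma ideal_sum (T : eqType) (l : seq T) (F : T -> KP L R) :
  (forall i, i \in l -> I (F i)) -> I (\sum_(i <- l) F i).
Proof.
move=> IF; rewrite big_seq; apply: (big_ind I) => //; first exact: ideal_zero.
exact: ideal_add.
Qed.

(** The vertices [v] with [p v] in [I]. *)
Definition ideal_vertices : set (obj L) := [set v | I (p v)].

Lemma ideal_vertices_hereditary : hereditary ideal_vertices.
Proof.
move=> a Ia; rewrite /ideal_vertices /=.
have -> : p (src a) = g a ** (p (rng a) ** s a) by rewrite kp_ps kp_gs ?eqxx.
by apply: ideal_mull => //; exact: ideal_mulr.
Qed.

Lemma ideal_vertices_saturated : saturated ideal_vertices.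
Proof.
move=> v n In; rewrite /ideal_vertices /=.
have [l lE] := finite_enumerates (Lrf v n); rewrite (kp_p_sum lE).
apply: ideal_sum => a /(enumeratesP lE a).1 va; rewrite -(kp_sp a).
by apply: ideal_mulr => //; apply: ideal_mull => //; apply: In; exists a.
Qed.

Lemma ideal_full : ideal_vertices = setT -> I = setT.
Proof.
move=> IT; have Ip v : I (p v) by have : ideal_vertices v by rewrite IT.
apply/seteqP; split=> // x _; elim/kp_ind: x => //.
- by move=> a; rewrite -kp_ps; exact: ideal_mulr.
- by move=> a; rewrite -kp_pg; exact: ideal_mulr.
- exact: ideal_zero.
- exact: ideal_add.
- exact: ideal_scale.
- by move=> x y Ix _; exact: ideal_mulr.
Qed.

Lemma trivial_hersat_ideal : trivial_hersat L ->
  ideal_vertices = set0 \/ I = setT.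
Proof.
move=> triv; have [||->|/ideal_full ->] := triv ideal_vertices.
- exact: ideal_vertices_hereditary.
- exact: ideal_vertices_saturated.
- by left.
- by right.
Qed.

End Ideal.

(** * Spanning by monomials *)

(** The span of the monomials [s a ** g b] with [Q (a, b)]. *)
Definition kp_span (Q : mor L * mor L -> Prop) : set (KP L R) :=
  [set x | exists2 l : seq (R * (mor L * mor L)), (forall t, t \in l -> Q t.2) &
     x = \sum_(t <- l) t.1 *: (s t.2.1 ** g t.2.2)].

Section Span.
Variable Q : mor L * mor L -> Prop.

Lemma kp_span0 : kp_span Q 0.
Proof. by exists [::]; rewrite ?big_nil. Qed.

Lemma kp_spanD x y : kp_span Q x -> kp_span Q y -> kp_span Q (x + y).
Proof.
case=> l lQ ->; case=> l' lQ' ->; exists (l ++ l'); last by rewrite big_cat.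
by move=> t; rewrite mem_cat => /orP[/lQ|/lQ'].
Qed.

Lemma kp_spanZ r x : kp_span Q x -> kp_span Q (r *: x).
Proof.
case=> l lQ ->; exists [seq (r * t.1, t.2) | t <- l].
  by move=> _ /mapP[t /lQ Qt ->].
by rewrite big_map scaler_sumr; apply: eq_bigr => t _; rewrite scalerA.
Qed.

Lemma kp_span_gen a b : Q (a, b) -> kp_span Q (s a ** g b).
Proof.
move=> Qab; exists [:: (1, (a, b))]; last by rewrite big_seq1 scale1r.
by move=> t; rewrite mem_seq1 => /eqP ->.
Qed.

Lemma kp_span_sum (T : eqType) (l : seq T) (F : T -> KP L R) :
  (forall i, i \in l -> kp_span Q (F i)) -> kp_span Q (\sum_(i <- l) F i).
Proof.
move=> QF; rewrite big_seq; apply: (big_ind (kp_span Q)) => //.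
  exact: kp_span0.
exact: kp_spanD.
Qed.

End Span.

Section Monomials.
Hypothesis Lrf : row_finite L.

Let matching (t : mor L * mor L) : Prop := src t.1 = src t.2.

(** Left multiplication by a ghost path: expanding [s a ** g b] by (KP4) makes
    the degree of the real part large enough for (KP3) to apply. *)
Lemma ghost_mul_span c a b : src a = src b ->
  kp_span matching (g c ** (s a ** g b)).
Proof.
move=> ab; have [l lE] := finite_enumerates (Lrf (src a) (deg c)).
rewrite (kp_sg_expand ab lE) kp_mul_sumr; apply: kp_span_sum => e.
case/(enumeratesP lE e) => re de.
have le : Nk_le (deg c) (deg (comp a e)).
  by rewrite deg_comp // de addrC Nk_le_addr.
rewrite -(factorE le) -kp_ss ?src_pre // !kp_mulA kp_gs ?deg_pre //.
case: eqP => [ce|_]; last by rewrite !kp_mul0l; exact: kp_span0.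
rewrite [in p _]ce src_pre // kp_ps; apply: kp_span_gen; rewrite /matching /=.
by rewrite src_suf // !src_comp // -ab.
Qed.

Lemma kp_span_mull x y : kp_span matching y -> kp_span matching (x ** y).
Proof.
elim/kp_ind: x y => [v|a|c||x x' IHx IHx'|r x IHx|x x' IHx IHx'] y; last first.
- by move=> Sy; rewrite -kp_mulA; apply/IHx/IHx'.
- by move=> Sy; rewrite -kp_scaleAl; apply/kp_spanZ/IHx.
- by move=> Sy; rewrite kp_mulDl; apply: kp_spanD; [exact: IHx|exact: IHx'].
- by rewrite kp_mul0l => _; exact: kp_span0.
- case=> l lS ->; rewrite kp_mul_sumr; apply: kp_span_sum => t /lS mt.
  by rewrite -kp_scaleAr; apply: kp_spanZ; exact: ghost_mul_span.
all: case=> l lS ->; rewrite kp_mul_sumr; apply: kp_span_sum => t /lS mt.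
all: rewrite -kp_scaleAr kp_mulA; apply: kp_spanZ.
- have [e|e] := eqVneq (src a) (rng t.2.1); last first.
    by rewrite kp_ss0 // kp_mul0l; exact: kp_span0.
  by rewrite kp_ss //; apply: kp_span_gen; rewrite /matching /= src_comp.
- have [->|/negPf e] := eqVneq v (rng t.2.1).
    by rewrite kp_ps; exact: kp_span_gen.
  by rewrite -kp_ps kp_mulA kp_pp e !kp_mul0l; exact: kp_span0.
Qed.

(** Every element is a combination of monomials, because the span of the
    monomials contains the generators and is stable under multiplication by any
    element on the left. *)
Lemma kp_span_full x : kp_span matching x.
Proof.
elim/kp_ind: x => [v|a|a||x y|r x|x y _].
- rewrite -[p v](_ : s (idm L v) ** g (idm L v) = _); first exact: kp_span_gen.
  by rewrite kp_s_id kp_g_id kp_pp eqxx.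
- by rewrite -kp_sp -kp_g_id; apply: kp_span_gen; rewrite /matching /= src_id.
- by rewrite -kp_pg -kp_s_id; apply: kp_span_gen; rewrite /matching /= src_id.
- exact: kp_span0.
- exact: kp_spanD.
- exact: kp_spanZ.
- exact: kp_span_mull.
Qed.

(** All monomials of a homogeneous element can be expanded by (KP4) to have
    ghost parts of the same degree [N], hence real parts of the same degree. *)
Lemma kp_homog_aligned (n : Zk k) x : kp_homog n x -> exists N : Nk k,
  kp_span (fun t => [/\ src t.1 = src t.2,
    Nk_int (deg t.1) = Nk_int N + n & deg t.2 = N]) x.
Proof.
(* Any common upper bound of the degrees of the ghost parts would do. *)
case=> l lS ->; pose N := \sum_(t <- l) deg t.2.2; exists N.
apply: kp_span_sum => t tl; have [mt dt] := lS t tl; apply: kp_spanZ.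
have le : Nk_le (deg t.2.2) N by rewrite /N (big_rem t) //= Nk_le_addr.
have [l' lE] := finite_enumerates (Lrf (src t.2.1) (Nk_sub N (deg t.2.2))).
rewrite (kp_sg_expand mt lE); apply: kp_span_sum => c.
case/(enumeratesP lE c) => rc dc; apply: kp_span_gen => /=.
have mc : src t.2.2 = rng c by rewrite -mt.
rewrite !src_comp ?deg_comp // dc Nk_subK //; split=> //.
rewrite Nk_int_add.
have -> : Nk_int (deg t.2.1) = Nk_int (deg t.2.2) + n.
  by rewrite -dt addrC subrK.
by rewrite -[in RHS](Nk_subK le) !Nk_int_add addrAC.
Qed.

(** A homogeneous element of a basic ideal is zero when the ideal contains no
    vertex: after alignment of the degrees, multiplying by [g a] on the left and
    by [s b] on the right isolates the coefficient of [s a ** g b]. *)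
Lemma homogeneous_zero (I : set (KP L R)) (n : Zk k) x :
  kp_ideal I -> kp_basic I -> ideal_vertices I = set0 ->
  I x -> kp_homog n x -> x = 0.
Proof.
move=> iI bI I0 Ix /kp_homog_aligned[N [l lQ xE]].
rewrite xE (sum_group l (fun q => s q.1 ** g q.2)) big1_seq // => q.
rewrite mem_undup => /andP[_ /mapP[t0 /lQ[m0 d0 e0] qE]].
rewrite -{}qE {t0} in m0 d0 e0.
set c := (\sum_(t <- l | _) _).
suff cE : g q.1 ** x ** s q.2 = c *: p (src q.1).
  have [->|c0] := eqVneq c 0; first by rewrite scale0r.
  have : ideal_vertices I (src q.1).
    apply: (bI c) => //; rewrite -cE.
    by apply: (ideal_mulr iI); exact: (ideal_mull iI).
  by rewrite I0.
rewrite xE kp_mul_sumr kp_mul_suml /c scaler_suml [RHS]big_mkcond.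
rewrite [LHS]big_seq [RHS]big_seq; apply: eq_bigr => t /lQ[mt dt et].
rewrite -kp_scaleAr -kp_scaleAl kp_mulA -kp_mulA kp_gs; last first.
  by apply: Nk_int_inj; rewrite d0 dt.
rewrite kp_gs ?et //.
have -> : (t.2 == q) = (t.2.1 == q.1) && (t.2.2 == q.2).
  by case: t.2 q {m0 d0 e0 c mt dt et} => [? ?] [? ?].
rewrite (eq_sym q.1).
have [_|] := eqVneq t.2.1 q.1; last by rewrite kp_mul0l scaler0.
have [e|] := eqVneq t.2.2 q.2; last by rewrite kp_mul0r scaler0.
by rewrite e -m0 kp_pp eqxx.
Qed.

Lemma trivial_hersat_graded_basic : trivial_hersat L ->
  graded_basic_ideal_simple L R.
Proof.
move=> triv I iI gI bI.
have [I0|->] := trivial_hersat_ideal iI Lrf triv; [left|by right].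
apply/seteqP; split=> [x /gI[l [y [_ ly ->]]]|_ ->]; last exact: ideal_zero.
rewrite big1_seq // => n /andP[_ /ly[In hn]].
exact: homogeneous_zero bI I0 In hn.
Qed.

Lemma trivial_hersat_basic : trivial_hersat L ->
  forall I : set (KP L R), kp_ideal I -> kp_basic I ->
    (exists v, I (p v)) -> I = setT.
Proof.
move=> triv I iI _ [v Iv].
have [I0|//] := trivial_hersat_ideal iI Lrf triv.
by have : ideal_vertices I v by []; rewrite I0.
Qed.

End Monomials.

End KumjianPask.

(** * A graded representation on functions of infinite paths *)

Section Representation.
Variables (k : nat) (L : kgraph k) (R : comNzRingType) (H : set (obj L)).
Hypotheses (hH : hereditary H) (sH : saturated H).
Implicit Types (a b c : mor L) (v : obj L) (t u : kp_term L R) (x : KP L R).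
Implicit Types (y : Nk k -> mor L) (z n w : Zk k).

(** The algebra acts on the functions of a point [y], of which only the infinite
    paths that avoid [H] matter, and of a level [z]. The levels record the
    degrees: they make the kernel of the representation a graded ideal. *)
Definition level_fun := (Nk k -> mor L) -> Zk k -> R.
Implicit Types f h : level_fun.

(** Vertices restrict functions to the paths with a given range; [a] and its
    ghost act by composition with the partial maps that remove the initial
    segment [a] and that prepend [a]. *)
Definition actP v f : level_fun := fun y z =>
  if `[< avoiding H y /\ rng (y 0) = v >] then f y z else 0.
Definition actS a f : level_fun := fun y z =>
  if `[< avoiding H y /\ y (deg a) = a >]
  then f (shift (deg a) y) (z - Nk_int (deg a)) else 0.
Definition actG a f : level_fun := fun y z =>
  if `[< avoiding H y /\ src a = rng (y 0) >]
  then f (cat_path a y) (z + Nk_int (deg a)) else 0.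

Lemma actS_id v : actS (idm L v) = actP v.
Proof.
apply/funext => f; apply/funext => y; apply/funext => z.
rewrite /actS /actP deg_id Nk_int0 subr0.
case: asboolP => [[ay yv]|no].
  by rewrite asboolT ?shift0 // yv rng_id.
by rewrite asboolF // => -[ay yv]; apply: no; rewrite (seg0 ay) yv.
Qed.

Lemma actG_id v : actG (idm L v) = actP v.
Proof.
apply/funext => f; apply/funext => y; apply/funext => z.
rewrite /actG /actP deg_id Nk_int0 addr0 src_id.
case: asboolP => [[ay ->]|no]; first by rewrite (cat_id ay) asboolT.
by rewrite asboolF // => -[ay yv]; apply: no.
Qed.

Lemma actPP v v' f :
  actP v (actP v' f) = if v == v' then actP v f else fun _ _ => 0.
Proof.
apply/funext => y; apply/funext => z; rewrite /actP.
case: asboolP => [[ay yv]|no]; last by case: ifP => // _; rewrite asboolF.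
rewrite -yv; case: eqVneq => [e|/eqP e]; first by rewrite !asboolT.
by rewrite asboolF // => -[_].
Qed.

Lemma actSS a b f : src a = rng b -> actS a (actS b f) = actS (comp a b) f.
Proof.
move=> ab; apply/funext => y; apply/funext => z; rewrite /actS deg_comp //.
case: asboolP => [[ay ya]|no]; last first.
  rewrite asboolF // => -[ay e]; apply: no; split=> //.
  have [s' e'] := seg_add ay (deg a) (deg b); rewrite e in e'.
  by have [] := comp_inj ab s' _ e'; rewrite ?(deg_seg ay).
have [s' e'] := seg_add ay (deg a) (deg b); rewrite ya in s' e'.
case: asboolP => [[_ yb]|no].
  rewrite (shift_shift ay) Nk_int_add opprD addrA asboolT //.
  by rewrite e' yb.
rewrite asboolF // => -[_ e]; apply: no; split; first exact: shift_avoiding.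
by rewrite e in e'; have [] := comp_inj ab s' erefl e'.
Qed.

Lemma actGG a b f : src a = rng b -> actG b (actG a f) = actG (comp a b) f.
Proof.
move=> ab; apply/funext => y; apply/funext => z.
rewrite /actG deg_comp // src_comp //; case: asboolP => // -[ay yb].
have acy := cat_avoiding hH ay yb.
rewrite asboolT; last by rewrite (rng_cat_path ay).
by rewrite (cat_cat ay) // Nk_int_add addrAC addrA.
Qed.

Lemma actPS a f : actP (rng a) (actS a f) = actS a f.
Proof.
apply/funext => y; apply/funext => z; rewrite /actP /actS.
case: (asboolP (_ /\ _ = a)) => [[ay ya]|_]; last by case: ifP.
by rewrite asboolT // -(rng_seg ay (deg a)) ya.
Qed.

Lemma actSP a f : actS a (actP (src a) f) = actS a f.
Proof.
apply/funext => y; apply/funext => z; rewrite /actP /actS.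
case: asboolP => // -[ay ya].
by rewrite asboolT // (rng_shift ay) ya; split=> //; exact: shift_avoiding.
Qed.

Lemma actPG a f : actP (src a) (actG a f) = actG a f.
Proof.
apply/funext => y; apply/funext => z; rewrite /actP /actG.
case: (asboolP (_ /\ src a = _)) => [[ay ya]|_]; last by case: ifP.
by rewrite asboolT.
Qed.

Lemma actGP a f : actG a (actP (rng a) f) = actG a f.
Proof.
apply/funext => y; apply/funext => z; rewrite /actP /actG.
case: asboolP => // -[ay ya].
have acy := cat_avoiding hH ay ya.
by rewrite asboolT // (rng_cat_path ay).
Qed.

Lemma actGS a b f : deg a = deg b ->
  actG a (actS b f) = if a == b then actP (src a) f else fun _ _ => 0.
Proof.
move=> dab; apply/funext => y; apply/funext => z; rewrite /actP /actG /actS.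
case: asboolP => [[ay ya]|no]; last first.
  by case: ifP => // _; rewrite asboolF // => -[ay ya]; apply: no.
rewrite -dab (cat_path_seg ay) //; case: eqVneq => [e|/eqP e]; last first.
  by rewrite asboolF // => -[].
rewrite !asboolT //; first by rewrite (shift_cat ay) // addrK.
by split=> //; exact: (cat_avoiding hH ay ya).
Qed.

Lemma actSG a f y z :
  actS a (actG a f) y z =
  if `[< avoiding H y /\ y (deg a) = a >] then f y z else 0.
Proof.
rewrite /actS /actG; case: asboolP => // -[ay ya].
rewrite asboolT; last first.
  by rewrite (rng_shift ay) ya; split=> //; exact: shift_avoiding.
by rewrite subrK -{1}ya (cat_shift ay).
Qed.

Lemma actP_sum v (m : Nk k) (l : seq (mor L)) f y z :
  enumerates (paths_from v m) l ->
  actP v f y z = \sum_(a <- l) actS a (actG a f) y z.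
Proof.
move=> lE; under eq_bigr => a _ do rewrite actSG.
rewrite /actP; case: asboolP => [[ay yv]|no]; last first.
  rewrite big1_seq // => a /andP[_ /(enumeratesP lE a).1[ra _]].
  rewrite asboolF // => -[ay ya]; apply: no; split=> //.
  by rewrite -(rng_seg ay (deg a)) ya.
transitivity (\sum_(a <- l) if y m == a then f y z else 0).
  rewrite sum_delta; last by case: lE.
  rewrite (_ : _ \in l = true) //; apply/(enumeratesP lE); split.
    by rewrite (rng_seg ay).
  exact: (deg_seg ay).
rewrite !big_seq; apply: eq_bigr => a /(enumeratesP lE a).1[_ ->].
case: eqVneq => [->|/eqP e]; first by rewrite asboolT.
by rewrite asboolF // => -[].
Qed.

(** The action of formal expressions, which factors through the congruence. *)
Fixpoint act t f : level_fun :=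
  match t with
  | TGen (GenP v) => actP v f
  | TGen (GenS a) => actS (val a) f
  | TGen (GenG a) => actG (val a) f
  | TZero => fun _ _ => 0
  | TAdd t u => fun y z => act t f y z + act u f y z
  | TOpp t => fun y z => - act t f y z
  | TScale r t => fun y z => r * act t f y z
  | TMul t u => act t (act u f)
  end.

Lemma act_tS a : act (tS R a) = actS a.
Proof.
have [[v ->]|[u ->]] := id_or_nzpath a; last by rewrite tS_nz.
by rewrite tS_id actS_id.
Qed.

Lemma act_tG a : act (tG R a) = actG a.
Proof.
have [[v ->]|[u ->]] := id_or_nzpath a; last by rewrite tG_nz.
by rewrite tG_id actG_id.
Qed.

Lemma act_linear t r f h :
  act t (fun y z => r * f y z + h y z) =
  fun y z => r * act t f y z + act t h y z.
Proof.
elim: t f h => [[v|a|a]||t IHt u IHu|t IHt|q t IHt|t IHt u IHu] f h /=.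
- apply/funext => y; apply/funext => z; rewrite /actP.
  by case: ifP => // _; rewrite mulr0 addr0.
- apply/funext => y; apply/funext => z; rewrite /actS.
  by case: ifP => // _; rewrite mulr0 addr0.
- apply/funext => y; apply/funext => z; rewrite /actG.
  by case: ifP => // _; rewrite mulr0 addr0.
- by apply/funext => y; apply/funext => z; rewrite mulr0 addr0.
- by apply/funext => y; apply/funext => z; rewrite IHt IHu mulrDr addrACA.
- by apply/funext => y; apply/funext => z; rewrite IHt mulrN opprD.
- by apply/funext => y; apply/funext => z; rewrite IHt mulrDr mulrCA.
- by rewrite IHu IHt.
Qed.

Lemma act_add t f h :
  act t (fun y z => f y z + h y z) = fun y z => act t f y z + act t h y z.
Proof.
have -> : (fun y z => f y z + h y z) = (fun y z => 1 * f y z + h y z).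
  by apply/funext => y; apply/funext => z; rewrite mul1r.
by rewrite act_linear; apply/funext => y; apply/funext => z; rewrite mul1r.
Qed.

Lemma act_0 t : act t (fun _ _ => 0) = fun _ _ => 0.
Proof.
have e := act_add t (fun _ _ => 0) (fun _ _ => 0).
apply/funext => y; apply/funext => z; apply: (addrI (act t (fun _ _ => 0) y z)).
transitivity (act t (fun (_ : Nk k -> mor L) (_ : Zk k) => 0 + 0) y z).
  by rewrite e.
by rewrite !addr0.
Qed.

Lemma act_scale t r f :
  act t (fun y z => r * f y z) = fun y z => r * act t f y z.
Proof.
have -> : (fun y z => r * f y z) = (fun y z => r * f y z + 0).
  by apply/funext => y; apply/funext => z; rewrite addr0.
rewrite (act_linear t r f (fun _ _ => 0)) act_0.
by apply/funext => y; apply/funext => z; rewrite addr0.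
Qed.

Lemma act_tsum (l : seq (kp_term L R)) f y z :
  act (tsum l) f y z = \sum_(t <- l) act t f y z.
Proof. by elim: l => [|t l IHl] /=; rewrite ?big_nil ?big_cons ?IHl. Qed.

Lemma act_cong t u : kp_cong t u -> act t = act u.
Proof.
elim=> {t u} /=.
- by [].
- by [].
- by move=> t u w _ -> _ ->.
- by move=> t t' u u' _ -> _ ->.
- by move=> t t' _ ->.
- by move=> r t t' _ ->.
- by move=> t t' u u' _ -> _ ->.
- by move=> t u w; apply/funext => f; apply/funext => y; apply/funext => z;
    rewrite addrA.
- by move=> t u; apply/funext => f; apply/funext => y; apply/funext => z;
    rewrite addrC.
- by move=> t; apply/funext => f; apply/funext => y; apply/funext => z;
    rewrite add0r.
- by move=> t; apply/funext => f; apply/funext => y; apply/funext => z;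
    rewrite addNr.
- by move=> r q t; apply/funext => f; apply/funext => y; apply/funext => z;
    rewrite mulrA.
- by move=> t; apply/funext => f; apply/funext => y; apply/funext => z;
    rewrite mul1r.
- by move=> r t u; apply/funext => f; apply/funext => y; apply/funext => z;
    rewrite mulrDr.
- by move=> r q t; apply/funext => f; apply/funext => y; apply/funext => z;
    rewrite mulrDl.
- by [].
- by [].
- by move=> t u w; apply/funext => f; rewrite act_add.
- by [].
- by move=> r t u; apply/funext => f; rewrite act_scale.
- by move=> u v; apply/funext => f; rewrite actPP; case: ifP.
- by move=> a b ab; apply/funext => f; rewrite act_tS actSS.
- by move=> a b ab; apply/funext => f; rewrite act_tG actGG.
- by move=> a; apply/funext => f; rewrite actPS.
- by move=> a; apply/funext => f; rewrite actSP.
- by move=> a; apply/funext => f; rewrite actPG.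
- by move=> a; apply/funext => f; rewrite actGP.
- move=> a b ab; apply/funext => f; rewrite actGS // (inj_eq val_inj).
  by case: ifP.
- move=> v m l lE; apply/funext => f; apply/funext => y; apply/funext => z.
  rewrite act_tsum big_map (actP_sum _ _ _ lE); apply: eq_bigr => a _ /=.
  by rewrite act_tS act_tG.
Qed.

(** The representation of the algebra. *)
Definition rep x : level_fun -> level_fun := act (repr x).

Lemma rep_pi t : rep (\pi_(KP L R) t) = act t.
Proof. exact/act_cong/kp_repr. Qed.

Lemma rep_mul x x' f : rep (x ** x') f = rep x (rep x' f).
Proof. by rewrite rep_pi. Qed.

Lemma rep_add x x' f y z : rep (x + x') f y z = rep x f y z + rep x' f y z.
Proof. by rewrite [x + x']/(kp_add x x') rep_pi. Qed.

Lemma rep_scale r x f y z : rep (r *: x) f y z = r * rep x f y z.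
Proof. by rewrite [r *: x]/(kp_scale r x) rep_pi. Qed.

Lemma rep0 f y z : rep 0 f y z = 0.
Proof. by rewrite [0]/(kp_zero L R) rep_pi. Qed.

Lemma rep_sum (T : Type) (l : seq T) (P : pred T) (F : T -> KP L R) f y z :
  rep (\sum_(i <- l | P i) F i) f y z = \sum_(i <- l | P i) rep (F i) f y z.
Proof.
apply: (big_morph (fun x => rep x f y z)) => [x x'|]; first exact: rep_add.
exact: rep0.
Qed.

(** Restriction of a function to one level. A homogeneous element of degree [n]
    computes its values at level [z] from those at level [z - n]. *)
Definition level w f : level_fun := fun y z => if z == w then f y z else 0.

Lemma rep_level n x w f y z : kp_homog n x ->
  rep x (level w f) y z = if z - n == w then rep x f y z else 0.
Proof.
case=> l lS ->; rewrite !rep_sum.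
rewrite (fun_if (fun e : R => e)).
transitivity (\sum_(t <- l) if z - n == w
    then rep (t.1 *: (kp_s R t.2.1 ** kp_g R t.2.2)) f y z else 0); last first.
  by case: ifP => // _; rewrite big1.
rewrite !big_seq; apply: eq_bigr => t /lS[_ tn].
rewrite !rep_scale !rep_mul !rep_pi act_tS act_tG /actS /actG.
case: asboolP => _; last by rewrite mulr0 if_same.
case: asboolP => _; last by rewrite mulr0 if_same.
rewrite /level -tn opprB addrA addrAC.
by case: eqP; rewrite ?mulr0.
Qed.

(** The elements that act by zero. *)
Definition kernel : set (KP L R) := [set x | rep x = fun _ _ _ => 0].

Lemma kernelP x : kernel x <-> forall f y z, rep x f y z = 0.
Proof.
split=> [-> //|e]; apply/funext => f; apply/funext => y; apply/funext => z.
exact: e.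
Qed.

Lemma kernel_ideal : kp_ideal kernel.
Proof.
split.
- by apply/kernelP => f y z; rewrite rep0.
- move=> x x' /kernelP Kx /kernelP Kx'; apply/kernelP => f y z.
  by rewrite rep_add Kx Kx' addr0.
- by move=> r x /kernelP Kx; apply/kernelP => f y z; rewrite rep_scale Kx mulr0.
- move=> x x' Kx'; apply/kernelP => f y z.
  by rewrite rep_mul [rep x']Kx' /rep act_0.
- by move=> x x' /kernelP Kx; apply/kernelP => f y z; rewrite rep_mul Kx.
Qed.

Lemma kernel_p v : H v -> kernel (kp_p R v).
Proof.
move=> Hv; apply/kernelP => f y z; rewrite rep_pi /= /actP asboolF //.
by move=> [ay yv]; apply: (seg_notin ay (n := 0)); rewrite (seg0 ay) src_id yv.
Qed.

(** A vertex outside of [H] starts an infinite path that avoids [H], on which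
    [r *: p v] multiplies the constant function [1] by [r]. *)
Lemma kernel_scale_p r v : r != 0 -> kernel (r *: kp_p R v) -> H v.
Proof.
move=> /eqP r0 /kernelP K; apply: contrapT => Hv.
have [y ay yv] := avoiding_exists hH sH Hv.
apply: r0; have := K (fun _ _ => 1) y 0.
by rewrite rep_scale rep_pi /= /actP asboolT // mulr1.
Qed.

Lemma kernel_basic : kp_basic kernel.
Proof. by move=> r v r0 /(kernel_scale_p r0); exact: kernel_p. Qed.

(** The homogeneous component of degree [n] of [x] is seen by applying [x] to a
    function restricted to one level. *)
Lemma kernel_graded : row_finite L -> kp_graded kernel.
Proof.
move=> Lrf x Kx; have [l lS xE] := kp_span_full Lrf x.
pose d (t : R * (mor L * mor L)) := Nk_int (deg t.2.1) - Nk_int (deg t.2.2).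
pose F (t : R * (mor L * mor L)) := t.1 *: (kp_s R t.2.1 ** kp_g R t.2.2).
pose c n := \sum_(t <- l | d t == n) F t.
have xE' : x = \sum_(n <- undup (map d l)) c n by rewrite xE (sum_fibers _ d).
have ch n : kp_homog n (c n).
  exists [seq t <- l | d t == n]; last by rewrite big_filter.
  by move=> t; rewrite mem_filter => /andP[/eqP dt /lS].
exists (undup (map d l)), c; split=> [|n nl|//]; first exact: undup_uniq.
split=> //; apply/kernelP => f y z.
have /kernelP/(_ (level (z - n) f) y z) := Kx.
rewrite xE' rep_sum; under eq_bigr => m _ do
  rewrite (rep_level _ _ _ _ (ch m)) (inj_eq (addrI z)) (inj_eq oppr_inj)
    (eq_sym m).
by rewrite sum_delta ?undup_uniq // nl.
Qed.

End Representation.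

Section Converse.
Variables (k : nat) (L : kgraph k) (R : comNzRingType).
Hypotheses (Lrf : row_finite L) (Lns : no_sources L).

(** The representation associated with the empty set detects every vertex. *)
Lemma kp_p_neq0 v : kp_p R v <> 0 :> KP L R.
Proof.
have h0 : hereditary (set0 : set (obj L)) by [].
have s0 : saturated (set0 : set (obj L)).
  by move=> u n; have [a ua] := Lns u n => /(_ (src a)); apply; exists a.
move=> p0; apply: (kernel_scale_p h0 s0 (oner_neq0 R) (v := v)).
rewrite p0 scaler0; exact: ideal_zero (kernel_ideal R h0).
Qed.

Lemma kernel_full (H : set (obj L)) : hereditary H -> saturated H ->
  kernel H = [set: KP L R] -> H = setT.
Proof.
move=> hH sH KT; apply/seteqP; split=> // v _.
by apply: (kernel_scale_p hH sH (oner_neq0 R)); rewrite KT.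
Qed.

Lemma graded_basic_trivial_hersat :
  graded_basic_ideal_simple L R -> trivial_hersat L.
Proof.
move=> simp H hH sH.
have [K0|] := simp _ (kernel_ideal R hH) (kernel_graded hH Lrf)
  (kernel_basic hH sH); last by right; exact: kernel_full.
left; apply/seteqP; split=> // v /(kernel_p R hH); rewrite K0.
exact: kp_p_neq0.
Qed.

Lemma basic_trivial_hersat :
  (forall I : set (KP L R), kp_ideal I -> kp_basic I ->
    (exists v, I (kp_p R v)) -> I = setT) -> trivial_hersat L.
Proof.
move=> simp H hH sH; have [->|/set0P[v Hv]] := eqVneq H set0; [by left|right].
apply: kernel_full => //; apply: simp.
- exact: kernel_ideal.
- exact: kernel_basic.
- by exists v; exact: kernel_p.
Qed.

End Converse.

Theorem theorem4p9 (k : nat) (hk : (0 < k)%N) (L : kgraph k)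
    (Lrf : row_finite L) (Lns : no_sources L) (R : comNzRingType) :
  [<-> cofinal L;
       simple_monoid (@tal_act k L);
       forall H : set (obj L), hereditary H -> saturated H ->
         H = set0 \/ H = [set: obj L];
       graded_basic_ideal_simple L R;
       forall I : set (KP L R), kp_ideal I -> kp_basic I ->
         (exists v : obj L, I (kp_p R v)) -> I = [set: KP L R]].
Proof.
tfae.
- by move=> /cofinal_trivial_hersat; exact: trivial_hersat_simple.
- exact: simple_trivial_hersat.
- exact: trivial_hersat_graded_basic.
- by move=> /(graded_basic_trivial_hersat Lrf Lns); exact: trivial_hersat_basic.
- by move=> /basic_trivial_hersat; exact: trivial_hersat_cofinal.
Qed.
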